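(* (Almost-sure convergence.) Suppose Assumption 1 holds, with a common $\delta\in[0,1/2)$ in (i.b), (ii.c), (iii.a) and (iii.b). Then the estimation error $e_0(t)=X(t)-\mathbf{1}_N\otimes\theta$ of the event-triggered distributed estimation algorithm satisfies $$\mathbb{P}\Big\{\lim_{t\to\infty}\frac{e_0(t)}{\alpha^{\delta}(t)}=0\Big\}=1.$$
   Context: Graph: $\mathcal{G}$ is a weighted digraph on $\mathcal{V}=\{1,\dots,N\}$ with adjacency matrix $\mathcal{A}=[a_{i,j}]$, $a_{i,j}\ge0$, $a_{i,i}=0$; $a_{i,j}>0$ means a link from $j$ to $i$. $\mathcal{N}_i=\{j:a_{i,j}>0\}$ (parents of $i$), $\mathcal{N}_i^c=\{j:a_{j,i}>0\}$ (children of $i$). Laplacian $\mathcal{L}=\mathcal{D}-\mathcal{A}$, $\mathcal{D}=\mathrm{diag}\{\sum_ja_{1,j},\dots,\sum_j a_{N,j}\}$, $\bar{\mathcal{L}}=(\mathcal{L}+\mathcal{L}^{\sf T})/2$. Model: unknown $\theta\in\mathbb{R}^M$; sensor $i$ measures $y_i(t)=H_i(t)\theta+v_i(t)$, $H_i(t)\in\mathbb{R}^{m_i\times M}$ known (random), $v_i(t)\in\mathbb{R}^{m_i}$ noise. $\bar D_H(t)=\mathrm{blockdiag}\{H_1^{\sf T}(t),\dots,H_N^{\sf T}(t)\}$, $V(t)=[v_1^{\sf T}(t),\dots,v_N^{\sf T}(t)]^{\sf T}$, $\mathcal{F}(t)=\sigma(\bar D_H(s),V(s),0\le s\le t)$,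 $\mathcal{F}(-1)=\{\emptyset,\Omega\}$. Algorithm: each sensor $i$ has a deterministic fixed initial estimate $x_i(0)\in\mathbb{R}^M$, deterministic step sizes $\alpha_i(t)>0$ and thresholds $f_i(t)\ge0$. Let $\hat x_i(t)$ denote the last estimate sent by sensor $i$ up to time $t$: $\hat x_i(0)=x_i(0)$ (sensor $i$ sends at $t=0$), and for $t\ge1$, if $\|x_i(t)-\hat x_i(t-1)\|>f_i(t)$ then sensor $i$ sends (an event is triggered) and $\hat x_i(t)=x_i(t)$, otherwise $\hat x_i(t)=\hat x_i(t-1)$. The update is $$x_i(t+1)=x_i(t)+\alpha_i(t)H_i^{\sf T}(t)(y_i(t)-H_i(t)x_i(t))+\alpha_i(t)\sum_{j\in\mathcal{N}_i}a_{i,j}(\hat x_j(t)-x_i(t)).$$ $X(t)=[x_1^{\sf T}(t),\dots,x_N^{\sf T}(t)]^{\sf T}$; $f_{\max}(t)=\max_i f_i(t)$, $f_{\min}(t)=\min_i f_i(t)$. Assumption 1: (i.a) there is a deterministic sequence $\{\alpha(t)\}$ with $\alpha_i(t)/\alpha(t)\to1$ for all $i$, $\alpha(t)>0$, $\alpha(t)\to0$, $\sum_t\alpha(t)=\infty$, and $1/\alpha(t+1)-1/\alpha(t)\to\alpha_0\ge0$. (i.b) $\sum_{t}\alpha(t)^{2(1-\delta)}<\infty$ for some $\delta\in[0,1/2)$. (ii.a) $\{\bar D_H(t)\}$ and $\{V(t)\}$ are independent sequences. (ii.b) $\{V(t)\}$ is a martingale difference sequence w.r.t. $\{\mathcal{F}(t)\}$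 and for some $\rho>2$, $\sup_t\mathbb{E}\{\|V(t)\|^\rho\mid\mathcal{F}(t-1)\}=c_V<\infty$ a.s. (ii.c) $\sup_t\|\bar D_H(t)\|^2\le D<\infty$ a.s., and there exist $h\in\mathbb{N}^+$, $\lambda>0$ such that for all $m\in\mathbb{N}$ and some $\delta\in[0,1/2)$, $\lambda_{\min}\big[\sum_{t=mh}^{(m+1)h-1}\mathbb{E}\{\bar{\mathcal{L}}\otimes I_M+\bar D_H(t)\bar D_H^{\sf T}(t)\mid\mathcal{F}(mh-1)\}\big]\ge\lambda+h\alpha_0\delta$ a.s. (iii.a) $f_{\max}(t)/\alpha^\delta(t)\to0$ for some $\delta\in[0,1/2)$. (iii.b) $\sum_t\alpha(t)^{1-\delta}f_{\max}(t)<\infty$ for some $\delta\in[0,1/2)$. *)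

(* Defs.v *)
From HB Require Import structures.
From mathcomp Require Import all_boot all_order all_algebra.
From mathcomp Require Import all_classical all_reals all_analysis.
Set Implicit Arguments. Unset Strict Implicit. Unset Printing Implicit Defensive.
Import Order.TTheory GRing.Theory Num.Theory.
Import numFieldNormedType.Exports.
Local Open Scope classical_set_scope.
Local Open Scope ring_scope.

Section Defs.
Variable R : realType.

Definition vnorm (n : nat) (x : 'cV[R]_n) : R := Num.sqrt (\sum_(k < n) x k 0 ^+ 2).

Definition opnorm (p q : nat) (A : 'M[R]_(p, q)) : R :=
  sup [set vnorm (A *m x) | x in [set x : 'cV[R]_q | vnorm x <= 1]].

Definition lambda_min (n : nat) (A : 'M[R]_n) : R := inf [set a : R | eigenvalue A a].

Definition stack (N M : nat) (z : 'I_N -> 'cV[R]_M) : 'cV[R]_(\sum_(i < N) M) :=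
  @mxcol R N (fun _ => M) 1 z.

Definition DHmx (N M : nat) (m : 'I_N -> nat) (Hs : forall i : 'I_N, 'M[R]_(m i, M))
  : 'M[R]_(\sum_(i < N) M, \sum_(i < N) m i) :=
  @mxblock R N N (fun _ => M) m (fun i j => if i == j then (Hs j)^T else 0).

Definition laplacian (N : nat) (a : 'I_N -> 'I_N -> R) : 'M[R]_N :=
  diag_mx (\row_i \sum_(j < N) a i j) - \matrix_(i, j) a i j.
Definition Lbar (N : nat) (a : 'I_N -> 'I_N -> R) : 'M[R]_N :=
  2^-1 *: (laplacian a + (laplacian a)^T).
Definition LbarI (N M : nat) (a : 'I_N -> 'I_N -> R) : 'M[R]_(\sum_(i < N) M) :=
  @mxblock R N N (fun _ => M) (fun _ => M) (fun i j => (Lbar a i j)%:M).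

Definition fmax (N : nat) (f : 'I_N -> nat -> R) (t : nat) : R :=
  \big[Num.max/0]_(i < N) f i t.

(* The event-triggered algorithm, for one fixed sample path.
   traj t = (x(t), hat x(t)). *)
Fixpoint traj (N M : nat) (m : 'I_N -> nat) (a : 'I_N -> 'I_N -> R)
  (alp f : 'I_N -> nat -> R) (theta : 'cV[R]_M) (x0 : 'I_N -> 'cV[R]_M)
  (Hs : forall i : 'I_N, nat -> 'M[R]_(m i, M)) (vs : forall i : 'I_N, nat -> 'cV[R]_(m i))
  (t : nat) : ('I_N -> 'cV[R]_M) * ('I_N -> 'cV[R]_M) :=
  match t with
  | 0%N => (x0, x0)
  | t'.+1 =>
    let: (x, xh) := traj a alp f theta x0 Hs vs t' in
    let x' := fun i => x i
        + alp i t' *: ((Hs i t')^T *m ((Hs i t' *m theta + vs i t') - Hs i t' *m x i))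
        + alp i t' *: \sum_(j < N | 0 < a i j) a i j *: (xh j - x i) in
    let xh' := fun i => if f i t' .+1 < vnorm (x' i - xh i) then x' i else xh i in
    (x', xh')
  end.

Section Prob.
Context (d : measure_display) (T : measurableType d) (P : probability T R).

Definition cond_exp_version (G : set (set T)) (X Y : T -> R) : Prop :=
  [/\ P.-integrable setT (EFin \o X),
      (forall B : set R, measurable B -> G (Y @^-1` B)),
      P.-integrable setT (EFin \o Y) &
      (forall A, G A -> (\int[P]_(w in A) (Y w)%:E = \int[P]_(w in A) (X w)%:E)%E)].

Variables (N M : nat) (m : 'I_N -> nat).
Variables (H : forall i : 'I_N, nat -> T -> 'M[R]_(m i, M))
          (v : forall i : 'I_N, nat -> T -> 'cV[R]_(m i)).

Definition filtr (t : nat) : set (set T) :=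
  <<s [set A | exists (i : 'I_N) (s : nat), (s <= t)%N /\ exists B : set R, measurable B /\
        ((exists r c, A = (fun w => H i s w r c) @^-1` B) \/
         (exists k, A = (fun w => v i s w k 0) @^-1` B))] >>.

Definition filtr_prev (t : nat) : set (set T) :=
  if t is t'.+1 then filtr t' else [set set0; setT].

Definition sigmaH : set (set T) :=
  <<s [set A | exists (i : 'I_N) (s : nat) r c (B : set R), measurable B /\
        A = (fun w => H i s w r c) @^-1` B] >>.
Definition sigmaV : set (set T) :=
  <<s [set A | exists (i : 'I_N) (s : nat) k (B : set R), measurable B /\
        A = (fun w => v i s w k 0) @^-1` B] >>.

Definition DH (t : nat) (w : T) := DHmx (fun i => H i t w).
Definition Vst (t : nat) (w : T) : 'cV[R]_(\sum_(i < N) m i) :=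
  @mxcol R N m 1 (fun i => v i t w).

End Prob.
End Defs.

(* Main.v *)
(* Stack the errors into e(t).  The algorithm reads
     e(t+1) = e(t) + diag(alpha_i(t)) (- G(t) e(t) + eps(t) + B(t) V(t)),
   where G(t) = L (x) I + B(t) B(t)^T, B(t) = D_H(t) and |eps(t)| <= C f_max(t).
   Over a block of h steps starting at m h, with p = alpha(m h), everything but
   the drift - 2 p e^T G e, the noise and the threshold term p f |e| is O(p^2).
   Conditioning on the past turns the drift into the excitation matrix, and
   p f |e| <= p^(1-delta) f (p^(2 delta) + |e|^2) with p^(1-delta) f = o(p), so
   z_m = |e(m h)|^2 / p^(2 delta) satisfies
     E[z_(m+1); A] <= (1 - lambda p) E[z_m; A] + b_m
   for every event A of the past, with deterministic summable b_m: the loss from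
   the growth of p^(-2 delta) is exactly compensated by h alpha_0 delta.  As the
   b_m are deterministic, the maximal inequality replaces the convergence theorem
   for almost supermartingales: E z_m is small for infinitely many m because
   sum p = oo, and then P(sup_(k >= m) z_k >= r) is small.  Inside a block the
   error moves by O(p (|e| + f + |V|)), and p^(1-delta) |V| -> 0 almost surely by
   the same inequality.
   The noise keeps zero mean given its past and the whole sequence H, by
   independence and the pi-lambda theorem. *)
Require Import Defs.
From HB Require Import structures.
From mathcomp Require Import all_boot all_order all_algebra.
From mathcomp Require Import all_classical all_reals all_analysis.
From mathcomp Require Import measurable_realfun ring lra.
Import Order.TTheory GRing.Theory Num.Theory.
Import numFieldNormedType.Exports.
Local Open Scope classical_set_scope.
Local Open Scope ring_scope.

Set Implicit Arguments. Unset Strict Implicit. Unset Printing Implicit Defensive.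

(** * Quadratic growth over one block of steps *)

(** Three obstacles shape the proof. The cross term of the noise is e(t)^T D_H(t) V(t), and D_H(t)
    is not known at time t-1, so the martingale property alone does not annihilate it; hence the
    enlargement of the past by H. Conditional expectations are given merely as versions, up to null
    sets, so every probabilistic step compares integrals over events of the past. Constants are
    fixed in the order C, K, eta, starting block: K depends only on C, h and the dimension, eta is
    then small relative to lambda / K, and finally the block index is taken large. The drift gains 2
    (lambda + h alpha0 delta) per unit of p; half a lambda is set aside for the block errors, and
    the growth of the weights takes at most 2 delta (h alpha0 + lambda / 4). Since delta < 1/2, more
    than lambda is left. *)

Section Block.
Context {R : realFieldType} {I J : finType}.
Implicit Types (x y e : I -> R).

Definition l1 {I : finType} (x : I -> R) : R := \sum_i `|x i|.
Definition sqs (x : I -> R) : R := \sum_i x i ^+ 2.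

Lemma l1_ge0 (I' : finType) (x : I' -> R) : 0 <= l1 x.
Proof. exact: sumr_ge0. Qed.

Lemma sqs_ge0 x : 0 <= sqs x.
Proof. by apply: sumr_ge0 => i _; exact: sqr_ge0. Qed.

Lemma le_l1 x i : `|x i| <= l1 x.
Proof. by rewrite /l1 (bigD1 i) //= lerDl sumr_ge0. Qed.

Lemma l1_triangle x y : l1 x <= l1 y + l1 (fun i => x i - y i).
Proof.
rewrite -big_split /=; apply: ler_sum => i _.
by rewrite (le_trans _ (ler_normD _ _)) // addrC subrK.
Qed.

Lemma sqs_le_l1 x : sqs x <= l1 x ^+ 2.
Proof.
rewrite expr2 {1}/l1 mulr_suml; apply: ler_sum => i _.
by rewrite -real_normK ?num_real // expr2 ler_wpM2l // le_l1.
Qed.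

Lemma sqr_sum_le (K : finType) (x : K -> R) :
  (\sum_i x i) ^+ 2 <= #|K|%:R * \sum_i x i ^+ 2.
Proof.
set A := \sum_i x i; set Q := \sum_i _.
have inner i : \sum_j (x i - x j) ^+ 2 = #|K|%:R * x i ^+ 2 - 2 * A * x i + Q.
  rewrite (eq_bigr (fun j => x i ^+ 2 - 2 * x i * x j + x j ^+ 2)); last first.
    by move=> j _; ring.
  rewrite big_split sumrB /= sumr_const -mulr_sumr -mulr_natl -/A -/Q; ring.
have : 0 <= \sum_i \sum_j (x i - x j) ^+ 2.
  by apply: sumr_ge0 => i _; apply: sumr_ge0 => j _; exact: sqr_ge0.
rewrite (eq_bigr _ (fun i _ => inner i)) big_split sumrB /= sumr_const.
rewrite -!mulr_sumr -[X in _ + X]mulr_natl -/A -/Q; lra.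
Qed.

Lemma l1_sqr_le x : l1 x ^+ 2 <= #|I|%:R * sqs x.
Proof.
apply: le_trans (sqr_sum_le _) _; rewrite ler_wpM2l //.
by apply: ler_sum => i _; rewrite real_normK ?num_real.
Qed.

Definition drive (G : I -> I -> R) (B : I -> J -> R) (eps : I -> R) (V : J -> R) x : I -> R :=
  fun i => - (\sum_j G i j * x j) + eps i + \sum_r B i r * V r.

Definition qform (G : I -> I -> R) x := \sum_i \sum_j x i * G i j * x j.

Section Step.
Variables (C p eta f : R) (b : I -> R) (G : I -> I -> R) (B : I -> J -> R)
  (eps : I -> R) (V : J -> R) (e e0 : I -> R).
Hypotheses (C0 : 0 <= C) (p0 : 0 <= p) (eta01 : 0 <= eta <= 1)
  (bp : forall i, `|b i - p| <= eta * p)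
  (GC : forall i j, `|G i j| <= C) (BC : forall i r, `|B i r| <= C)
  (epsC : forall i, `|eps i| <= C * f).
Let U := drive G B eps V e.
Let g := f + l1 V.

Let b_ge0 i : 0 <= b i.
Proof.
have := bp i; rewrite ler_norml => /andP[h _].
have : eta * p <= 1 * p by rewrite ler_wpM2r //; case/andP: eta01.
by lra.
Qed.

Let b_le i : b i <= 2 * p.
Proof.
have := bp i; rewrite ler_norml => /andP[_ h].
have : eta * p <= 1 * p by rewrite ler_wpM2r //; case/andP: eta01.
by lra.
Qed.

Lemma l1_drive : l1 U <= (#|I|%:R * C) * (l1 e + g).
Proof.
rewrite -mulrA mulr_natl -sumr_const; apply: ler_sum => i _.
rewrite /U /drive (le_trans (ler_normD _ _)) //.
have h1 : `|- (\sum_j G i j * e j) + eps i| <= C * l1 e + C * f.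
  rewrite (le_trans (ler_normD _ _)) // lerD // normrN.
  rewrite (le_trans (ler_norm_sum _ _ _)) // mulr_sumr ler_sum // => j _.
  by rewrite normrM ler_wpM2r.
have h2 : `|\sum_r B i r * V r| <= C * l1 V.
  rewrite (le_trans (ler_norm_sum _ _ _)) // mulr_sumr ler_sum // => j _.
  by rewrite normrM ler_wpM2r.
by rewrite (le_trans (lerD h1 h2)) // /g !mulrDr addrA.
Qed.

Lemma l1_step_drive : l1 (fun i => b i * U i) <= 2 * p * l1 U.
Proof.
rewrite mulr_sumr; apply: ler_sum => i _.
by rewrite normrM ler_wpM2r // ger0_norm.
Qed.

Lemma sqs_step_drive : sqs (fun i => b i * U i) <= (2 * p * l1 U) ^+ 2.
Proof.
apply: le_trans (sqs_le_l1 _) _.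
by rewrite ler_sqr ?l1_step_drive // nnegrE ?l1_ge0 // !mulr_ge0 // l1_ge0.
Qed.

(** Replacing [e] by the block start [e0] costs displacement times size, and replacing [b i] by [p]
    costs the relative step error [eta] times size squared. Both errors are bilinear, with entries
    of [G] as coefficients. *)
Lemma drift_step (dsp := l1 (fun i => e i - e0 i)) :
  \sum_i b i * (e i * - (\sum_j G i j * e j)) <=
  - p * qform G e0 + C * (2 * p * (dsp * (l1 e + l1 e0)) + eta * p * l1 e0 ^+ 2).
Proof.
rewrite -lerBlDl mulNr opprK /qform mulr_sumr -big_split /=.
(* The bound is itself a double sum, so the two sides can be compared entry by entry. *)
have -> : C * (2 * p * (dsp * (l1 e + l1 e0)) + eta * p * l1 e0 ^+ 2) =
  \sum_i \sum_j C * (2 * p * (`|e i - e0 i| * `|e j| + `|e0 i| * `|e j - e0 j|) +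
     eta * p * (`|e0 i| * `|e0 j|)).
  have dbl (x y : I -> R) : \sum_i \sum_j x i * y j = (\sum_i x i) * (\sum_j y j).
    by rewrite mulr_suml; apply: eq_bigr => i _; rewrite mulr_sumr.
  under eq_bigr => i _ do rewrite -mulr_sumr big_split /= -!mulr_sumr big_split /=.
  rewrite -mulr_sumr big_split /= -!mulr_sumr big_split /=.
  by rewrite !dbl -mulr_suml /dsp /l1; ring.
apply: ler_sum => i _.
have -> : b i * (e i * - (\sum_j G i j * e j)) + p * (\sum_j e0 i * G i j * e0 j) =
   \sum_j G i j * (p * (e0 i * e0 j) - b i * (e i * e j)).
  rewrite !mulrN addrC !mulr_sumr -sumrB.
  by apply: eq_bigr => j _; ring.
apply: ler_sum => j _.
apply: le_trans (ler_norm _) _; rewrite normrM ler_pM //.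
have -> : p * (e0 i * e0 j) - b i * (e i * e j) =
   - (b i * ((e i - e0 i) * e j + e0 i * (e j - e0 j)) + (b i - p) * (e0 i * e0 j)).
  by ring.
rewrite normrN (le_trans (ler_normD _ _)) // lerD //.
  rewrite normrM ler_pM //; first by rewrite ger0_norm.
  by rewrite (le_trans (ler_normD _ _)) // !normrM.
by rewrite !normrM ler_wpM2r // mulr_ge0.
Qed.

(** The square is expanded and each term estimated, except the noise: it vanishes only in
    expectation and must be kept exactly. *)
Lemma sqs_step (dsp := l1 (fun i => e i - e0 i)) (f0 : 0 <= f) :
  sqs (fun i => e i + b i * U i) <= sqs e
   - 2 * p * qform G e0 + \sum_i \sum_r 2 * (b i * e i * B i r) * V r
   + 2 * C * (2 * p * (dsp * (l1 e + l1 e0)) + eta * p * l1 e0 ^+ 2)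
   + 4 * p * C * f * l1 e + (2 * p * l1 U) ^+ 2.
Proof.
have -> : sqs (fun i => e i + b i * U i) = sqs e + 2 * (\sum_i b i * (e i * U i))
    + sqs (fun i => b i * U i).
  rewrite /sqs mulr_sumr -!big_split /=; apply: eq_bigr => i _; ring.
have -> : \sum_i b i * (e i * U i) = \sum_i b i * (e i * - (\sum_j G i j * e j))
   + \sum_i b i * (e i * eps i) + \sum_i \sum_r (b i * e i * B i r) * V r.
  rewrite -!big_split /=; apply: eq_bigr => i _.
  rewrite /U /drive !mulrDr mulr_sumr mulr_sumr; congr (_ + _).
  by apply: eq_bigr => r _; ring.
have /= h1 := drift_step.
have h2 : \sum_i b i * (e i * eps i) <= 2 * p * (C * f) * l1 e.
  rewrite mulr_sumr; apply: ler_sum => i _; apply: le_trans (ler_norm _) _.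
  rewrite !normrM mulrCA [leRHS]mulrC ler_wpM2l // ler_pM //.
  by rewrite ger0_norm.
have h3 := sqs_step_drive.
have -> : \sum_i \sum_r 2 * (b i * e i * B i r) * V r =
   2 * \sum_i \sum_r (b i * e i * B i r) * V r.
  rewrite mulr_sumr; apply: eq_bigr => i _; rewrite mulr_sumr.
  by apply: eq_bigr => r _; rewrite -!mulrA.
rewrite -/dsp in h1; lra.
Qed.

End Step.

(** [K] stands outside the quantification over paths and over [eta], so that [eta] can later be
    chosen small relative to [K]. [N0] is the size at the block start, [S] the total forcing by
    thresholds and noise. *)
Definition block_bound (h : nat) (C K : R) : Prop :=
  forall (e b : nat -> I -> R) (G : nat -> I -> I -> R) (B : nat -> I -> J -> R)
    (eps : nat -> I -> R) (V : nat -> J -> R) (f : nat -> R) (p eta : R),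
  0 <= p <= 1 -> 0 <= eta <= 1 ->
  (forall t i, (t < h)%N -> `|b t i - p| <= eta * p) ->
  (forall t i j, (t < h)%N -> `|G t i j| <= C) ->
  (forall t i r, (t < h)%N -> `|B t i r| <= C) ->
  (forall t i, (t < h)%N -> `|eps t i| <= C * f t) ->
  (forall t, 0 <= f t) ->
  (forall t i, (t < h)%N -> e t.+1 i = e t i + b t i * drive (G t) (B t) (eps t) (V t) (e t) i) ->
  let N0 := l1 (e 0%N) in let S := \sum_(t < h) (f t + l1 (V t)) in
  (forall t, (t <= h)%N -> l1 (e t) <= N0 + K * p * (N0 + S)) /\
  sqs (e h) <= sqs (e 0%N) - 2 * p * \sum_(t < h) qform (G t) (e 0%N)
    + \sum_(t < h) \sum_i \sum_r 2 * (b t i * e t i * B t i r) * V t r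
    + K * (p ^+ 2 * (N0 + S) ^+ 2 + eta * p * N0 ^+ 2 + p * (\sum_(t < h) f t) * N0).

Lemma block_ineq (h : nat) (C : R) : 0 <= C -> exists2 K : R, 0 <= K & block_bound h C K.
Proof.
move=> C0.
(* [C1] controls one application of the drive, [C2] is the Gronwall factor over [h] steps, [C3]
   bounds every drive in the block, [C4] the displacement from the block start per unit of [p], and
   [C5] the second-order part of one step, all relative to [N0 + S]. *)
pose C1 : R := #|I|%:R * C.
have C10 : 0 <= C1 by rewrite mulr_ge0.
pose C2 := (1 + 2 * C1) ^+ h.
have C21 : 1 <= C2 by rewrite exprn_ege1 //; lra.
pose C3 := C1 * (C2 + 1).
have C30 : 0 <= C3 by rewrite mulr_ge0 //; lra.
pose C4 := 2 * h%:R * C3.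
have h0 : (0 : R) <= h%:R by [].
have C40 : 0 <= C4 by rewrite mulr_ge0 // mulr_ge0.
pose C5 := 2 * C * (2 * (C4 * (C2 + 1))) + 4 * C * C2 + 4 * C * C4 + 4 * C3 ^+ 2.
have C50 : 0 <= C5.
  have C20 : 0 <= C2 by lra.
  have C21' : 0 <= C4 * (C2 + 1) by rewrite mulr_ge0 // addr_ge0.
  have := mulr_ge0 C0 C21'; have := mulr_ge0 C0 C20; have := mulr_ge0 C0 C40.
  by have := sqr_ge0 C3; rewrite /C5; lra.
pose K := C4 + h%:R * C5 + (2 * C) * h%:R + 4 * C.
have hC5 : 0 <= h%:R * C5 by rewrite mulr_ge0.
have hCC : 0 <= 2 * C * h%:R by rewrite mulr_ge0 // mulr_ge0.
exists K; first by rewrite /K; lra.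
move=> e b G B eps V f p eta /andP[p0 p1] eta01 bp GC BC epsC f0 rec N0 S.
have eta0 : 0 <= eta by case/andP: eta01.
have N00 : 0 <= N0 by exact: l1_ge0.
pose g t := f t + l1 (V t).
have g0 t : 0 <= g t by rewrite addr_ge0 // l1_ge0.
pose Sk k := \sum_(t < k) g t.
have Sk_le k : (k <= h)%N -> Sk k <= S.
  move=> kh; rewrite /Sk /S -!(big_mkord xpredT (fun t => g t)).
  rewrite [leRHS](big_cat_nat (n := k)) //= lerDl.
  by rewrite sumr_ge0.
have S0 : 0 <= S by rewrite sumr_ge0 // => t _; exact: g0.
have gS t : (t < h)%N -> g t <= S.
  move=> th; apply: le_trans (Sk_le t.+1 th).
  by rewrite /Sk big_ord_recr /= lerDr sumr_ge0.
have fS t : (t < h)%N -> f t <= S.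
  by move=> /gS; apply: le_trans; rewrite lerDl l1_ge0.
pose U t := drive (G t) (B t) (eps t) (V t) (e t).
have U1 t : (t < h)%N -> l1 (U t) <= C1 * (l1 (e t) + g t).
  by move=> th; apply: l1_drive => // *; [exact: GC|exact: BC|exact: epsC].
have stepU t : (t < h)%N -> l1 (fun i => e t.+1 i - e t i) <= 2 * p * l1 (U t).
  move=> th; apply: le_trans (_ : l1 (fun i => b t i * U t i) <= _).
    apply: ler_sum => i _; rewrite rec // addrAC subrr add0r //.
  by apply: (l1_step_drive (eta := eta)) => // i; exact: bp.
(* Discrete Gronwall inequality; [p <= 1] makes the growth factor independent of [p]. *)
have growth t : (t <= h)%N -> l1 (e t) <= (1 + 2 * C1) ^+ t * (N0 + Sk t).
  elim: t => [|t IH] th; first by rewrite expr0 mul1r /Sk big_ord0 addr0.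
  have {}IH := IH (ltnW th).
  apply: le_trans (l1_triangle _ (e t)) _.
  have hs := stepU t th; have hu := U1 t th.
  have hp : 2 * p * l1 (U t) <= 2 * (C1 * (l1 (e t) + g t)).
    rewrite -mulrA ler_pM2l //; apply: le_trans hu.
    by rewrite ler_piMl // l1_ge0.
  have A1 : 1 <= (1 + 2 * C1) ^+ t.+1 by rewrite exprn_ege1 //; lra.
  have h4 : (1 + 2 * C1) * l1 (e t) <= (1 + 2 * C1) * ((1 + 2 * C1) ^+ t * (N0 + Sk t)).
    by rewrite ler_wpM2l //; lra.
  have h5 : 2 * C1 * g t <= (1 + 2 * C1) ^+ t.+1 * g t.
    rewrite ler_wpM2r //.
    apply: le_trans (_ : (1 + 2 * C1) ^+ 1 <= _); first by rewrite expr1; lra.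
    by rewrite ler_weXn2l //; lra.
  rewrite /Sk big_ord_recr /= -/(Sk t) addrA mulrDr; rewrite exprS in h5 *; lra.
have e_le t : (t <= h)%N -> l1 (e t) <= C2 * (N0 + S).
  move=> th; apply: le_trans (growth t th) _; rewrite ler_pM //.
  - by rewrite exprn_ge0 //; lra.
  - by rewrite addr_ge0 // sumr_ge0.
  - by rewrite ler_weXn2l //; lra.
  - by rewrite lerD2l Sk_le.
have U_le t : (t < h)%N -> l1 (U t) <= C3 * (N0 + S).
  move=> th; apply: le_trans (U1 t th) _; rewrite /C3 -mulrA ler_wpM2l //.
  have := e_le t (ltnW th); have := gS t th; lra.
(* At most [h] increments of order [p]: the displacement is first order, so freezing the error in
   the drift, itself of order [p], is a second-order change. *)
have dsp_le t : (t <= h)%N -> l1 (fun i => e t i - e 0%N i) <= C4 * p * (N0 + S).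
  move=> th; suff : l1 (fun i => e t i - e 0%N i) <= t%:R * (2 * p * (C3 * (N0 + S))).
    move=> /le_trans; apply; rewrite /C4.
    have -> : 2 * h%:R * C3 * p * (N0 + S) = h%:R * (2 * p * (C3 * (N0 + S))) by ring.
    rewrite ler_wpM2r ?ler_nat // !mulr_ge0 //; lra.
  elim: t th => [|t IH] th.
    by rewrite mul0r /l1 big1 // => i _; rewrite subrr normr0.
  have {}IH := IH (ltnW th).
  rewrite -natr1 mulrDl mul1r.
  apply: le_trans (lerD IH (le_trans (stepU t th) _)); last first.
    by rewrite ler_wpM2l ?U_le // mulr_ge0.
  rewrite -big_split /=; apply: ler_sum => i _.
  by rewrite addrC (le_trans _ (ler_normD _ _)) // addrA subrK.
have e_le' t : (t <= h)%N -> l1 (e t) <= N0 + C4 * p * (N0 + S).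
  move=> th; apply: le_trans (l1_triangle _ (e 0%N)) _.
  by rewrite lerD2l dsp_le.
split.
  move=> t th; apply: le_trans (e_le' t th) _.
  rewrite lerD2l ler_wpM2r ?addr_ge0 // ler_wpM2r // /K; lra.
have key t : (t < h)%N -> sqs (e t.+1) <= sqs (e t) - 2 * p * qform (G t) (e 0%N)
    + \sum_i \sum_r 2 * (b t i * e t i * B t i r) * V t r
    + C5 * (p ^+ 2 * (N0 + S) ^+ 2) + 2 * C * (eta * p * N0 ^+ 2) + 4 * C * (p * f t * N0).
  move=> th.
  have -> : sqs (e t.+1) = sqs (fun i => e t i + b t i * U t i).
    by apply: eq_bigr => i _; rewrite rec.
  have := @sqs_step C p eta (f t) (b t) (G t) (B t) (eps t) (V t) (e t) (e 0%N)
    p0 eta01 (fun i => bp t i th) (fun i j => GC t i j th) (fun i => epsC t i th) (f0 t).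
  move=> /= /le_trans; apply.
  rewrite -/(U t) -/N0.
  set dsp := l1 _.
  have hd : dsp <= C4 * p * (N0 + S) by apply: dsp_le; exact: ltnW.
  have h1 : dsp * (l1 (e t) + N0) <= (C4 * p * (N0 + S)) * ((C2 + 1) * (N0 + S)).
    rewrite ler_pM ?l1_ge0 //; first by rewrite addr_ge0 ?l1_ge0.
    have := e_le t (ltnW th); lra.
  have h1' : 2 * p * (dsp * (l1 (e t) + N0)) <=
      2 * p * ((C4 * p * (N0 + S)) * ((C2 + 1) * (N0 + S))).
    by rewrite ler_wpM2l // mulr_ge0.
  have {h1 h1'}h1 := ler_wpM2l C0 h1'.
  have h2 : (2 * p * l1 (U t)) ^+ 2 <= (2 * p * (C3 * (N0 + S))) ^+ 2.
    have NS0 : 0 <= N0 + S by rewrite addr_ge0.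
    have le12 : 2 * p * l1 (U t) <= 2 * p * (C3 * (N0 + S)).
      by rewrite ler_wpM2l ?U_le // mulr_ge0.
    have pU0 : 0 <= 2 * p * l1 (U t) by rewrite mulr_ge0 ?l1_ge0 // mulr_ge0.
    by rewrite ler_sqr // nnegrE (le_trans pU0).
  (* The threshold term is moved to the block start as well; since [f t <= S], the change joins the
     second-order terms. *)
  have h3 : p * f t * l1 (e t) <= p * f t * N0 + C4 * (p ^+ 2 * (N0 + S) ^+ 2).
    have hf : p * f t * l1 (e t) <= p * f t * (N0 + C4 * p * (N0 + S)).
      by rewrite ler_wpM2l ?mulr_ge0 // e_le' // ltnW.
    apply: le_trans hf _; rewrite mulrDr lerD2l.
    have -> : C4 * (p ^+ 2 * (N0 + S) ^+ 2) = p * (N0 + S) * (C4 * p * (N0 + S)) by ring.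
    have NS0 : 0 <= N0 + S by rewrite addr_ge0.
    apply: ler_wpM2r; first by rewrite mulr_ge0 // mulr_ge0.
    by apply: ler_wpM2l => //; have := fS t th; lra.
  have {}h3 := ler_wpM2l C0 h3.
  have h4 : 0 <= 4 * C * C2 * (p ^+ 2 * (N0 + S) ^+ 2).
    have C20 : 0 <= C2 by lra.
    by rewrite mulr_ge0 // mulr_ge0 // ?sqr_ge0 // mulr_ge0.
  have -> : C5 * (p ^+ 2 * (N0 + S) ^+ 2) =
     2 * (C * (2 * p * ((C4 * p * (N0 + S)) * ((C2 + 1) * (N0 + S)))))
     + 4 * C * C2 * (p ^+ 2 * (N0 + S) ^+ 2) + 4 * (C * (C4 * (p ^+ 2 * (N0 + S) ^+ 2)))
     + (2 * p * (C3 * (N0 + S))) ^+ 2 by rewrite /C5; ring.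
  lra.
suff tel k : (k <= h)%N -> sqs (e k) <= sqs (e 0%N) - 2 * p * \sum_(t < k) qform (G t) (e 0%N)
    + \sum_(t < k) \sum_i \sum_r 2 * (b t i * e t i * B t i r) * V t r
    + k%:R * (C5 * (p ^+ 2 * (N0 + S) ^+ 2) + 2 * C * (eta * p * N0 ^+ 2))
    + 4 * C * (p * (\sum_(t < k) f t) * N0).
  apply: le_trans (tel h (leqnn _)) _.
  set a1 := p ^+ 2 * _ ^+ 2; set a2 := eta * p * _; set a3 := p * _ * N0.
  have a10 : 0 <= a1 by rewrite mulr_ge0 // sqr_ge0.
  have a20 : 0 <= a2 by rewrite !mulr_ge0 // sqr_ge0.
  have a30 : 0 <= a3 by rewrite !mulr_ge0 // sumr_ge0.
  have b1 := mulr_ge0 C40 a10; have b2 := mulr_ge0 C40 a20; have b3 := mulr_ge0 C40 a30.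
  have b4 := mulr_ge0 hC5 a20; have b5 := mulr_ge0 hC5 a30.
  have b6 := mulr_ge0 hCC a10; have b7 := mulr_ge0 hCC a30.
  have b8 := mulr_ge0 C0 a10; have b9 := mulr_ge0 C0 a20.
  rewrite /K; lra.
elim: k => [|k IH] kh; first by rewrite !big_ord0 !(mul0r, mulr0); lra.
have {}IH := IH (ltnW kh); have := key k kh.
rewrite !big_ord_recr /= -natr1; lra.
Qed.

End Block.
Arguments block_bound {R} I J h C K.

(** * Real-valued expectations and sub-sigma-algebras *)

Section Expectation.
Context {d : measure_display} {T : measurableType d} {R : realType} (P : probability T R).
Implicit Types (X Y Z W : T -> R) (A B : set T).

Definition L1 X : Prop := P.-integrable setT (EFin \o X).
Definition Ex X : R := Rintegral P setT X.

Lemma L1_measurable X : L1 X -> measurable_fun setT X.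
Proof. by move=> /measurable_int/measurable_EFinP. Qed.

Lemma L1_le X Y : measurable_fun setT X -> L1 Y ->
  {ae P, forall w, `|X w| <= Y w} -> L1 X.
Proof.
move=> mX iY XY; have /integrableP[mY Yoo] := iY.
apply/integrableP; split; first exact/measurable_EFinP.
apply: le_lt_trans Yoo; apply: ae_ge0_le_integral => //=.
- exact/measurable_EFinP/measurableT_comp.
- by apply/measurable_EFinP/measurableT_comp => //; exact/measurable_EFinP.
- apply: filterS XY => w h _; rewrite lee_fin; apply: le_trans h _; exact: ler_norm.
Qed.

Lemma L1_ext X Y : L1 X -> X =1 Y -> L1 Y.
Proof. by move=> h /funext <-. Qed.

Lemma L1_cst c : L1 (fun=> c).
Proof. exact: finite_measure_integrable_cst. Qed.

Lemma L1D X Y : L1 X -> L1 Y -> L1 (fun w => X w + Y w).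
Proof. by move=> h1 h2; have := integrableD measurableT h1 h2; apply: eq_integrable. Qed.

Lemma L1Z c X : L1 X -> L1 (fun w => c * X w).
Proof. by move=> h; have := integrableZl measurableT c h; apply: eq_integrable. Qed.

Lemma L1N X : L1 X -> L1 (fun w => - X w).
Proof. by move=> h; have := integrableN h; apply: eq_integrable. Qed.

Lemma L1B X Y : L1 X -> L1 Y -> L1 (fun w => X w - Y w).
Proof. by move=> h1 h2; apply: L1D => //; exact: L1N. Qed.

Lemma L1_sum (I : Type) (s : seq I) (F : I -> T -> R) :
  (forall i, L1 (F i)) -> L1 (fun w => \sum_(i <- s) F i w).
Proof.
move=> h; elim: s => [|i s IH].
  by apply: L1_ext (L1_cst 0) _ => w; rewrite big_nil.
by apply: L1_ext (L1D (h i) IH) _ => w; rewrite big_cons.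
Qed.

Lemma L1_norm X : L1 X -> L1 (fun w => `|X w|).
Proof. by move=> h; apply: integrable_norm. Qed.

Lemma L1_bounded X K : measurable_fun setT X -> (forall w, `|X w| <= K) -> L1 X.
Proof. by move=> mX XK; apply: L1_le (L1_cst K) _ => //; exact: aeW. Qed.

Lemma indic_norm_le1 A w : `|(\1_A w : R)| <= 1.
Proof. by rewrite indicE; case: (w \in A); rewrite ?normr1 ?normr0. Qed.

Lemma L1M_bounded X Z K : measurable_fun setT Z -> (forall w, `|Z w| <= K) -> L1 X ->
  L1 (fun w => Z w * X w).
Proof.
move=> mZ ZK iX; apply: (L1_le _ (L1Z K (L1_norm iX))).
  by apply: measurable_funM => //; exact: L1_measurable.
by apply: aeW => w; rewrite normrM ler_wpM2r.
Qed.

Lemma L1_indicM A X : measurable A -> L1 X -> L1 (fun w => \1_A w * X w).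
Proof.
move=> mA; apply: (@L1M_bounded _ _ 1); first exact: measurable_indic.
by move=> w; exact: indic_norm_le1.
Qed.

Lemma ExD X Y : L1 X -> L1 Y -> Ex (fun w => X w + Y w) = Ex X + Ex Y.
Proof. by move=> *; apply: RintegralD. Qed.

Lemma ExB X Y : L1 X -> L1 Y -> Ex (fun w => X w - Y w) = Ex X - Ex Y.
Proof. by move=> *; apply: RintegralB. Qed.

Lemma ExZ c X : L1 X -> Ex (fun w => c * X w) = c * Ex X.
Proof. by move=> *; apply: RintegralZl. Qed.

Lemma Ex_ext X Y : X =1 Y -> Ex X = Ex Y.
Proof. by move=> /funext ->. Qed.

Lemma Ex_cst c : Ex (fun=> c) = c.
Proof.
rewrite /Ex Rintegral_cst //; apply: etrans (mulr1 c); congr (_ * _).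
exact: (congr1 fine (probability_setT P)).
Qed.

Lemma Ex_sum (I : Type) (s : seq I) (F : I -> T -> R) : (forall i, L1 (F i)) ->
  Ex (fun w => \sum_(i <- s) F i w) = \sum_(i <- s) Ex (F i).
Proof.
move=> h; elim: s => [|i s IH].
  by rewrite big_nil -[RHS](Ex_cst 0); apply: Ex_ext => w; rewrite big_nil.
rewrite big_cons -IH -ExD //; last exact: L1_sum.
by apply: Ex_ext => w; rewrite big_cons.
Qed.

Lemma Ex_ge0 X : (forall w, 0 <= X w) -> 0 <= Ex X.
Proof. by move=> h; apply: Rintegral_ge0. Qed.

Lemma Ex_le X Y : L1 X -> L1 Y -> {ae P, forall w, X w <= Y w} -> Ex X <= Ex Y.
Proof.
move=> iX iY XY; rewrite -subr_ge0 -ExB //.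
have mD : measurable_fun setT (fun w => Y w - X w).
  by apply: measurable_funB; exact: L1_measurable.
have -> : Ex (fun w => Y w - X w) = Ex (fun w => `|Y w - X w|).
  rewrite /Ex /Rintegral; congr fine; apply: ae_eq_integral => //.
  - exact/measurable_EFinP.
  - by apply/measurable_EFinP; apply: measurableT_comp.
  - by apply: filterS XY => w h _; rewrite ger0_norm // subr_ge0.
by apply: Ex_ge0.
Qed.

Lemma Ex_norm_le X : L1 X -> `|Ex X| <= Ex (fun w => `|X w|).
Proof. by move=> h; apply: le_normr_Rintegral. Qed.

Lemma Ex_indic A : measurable A -> Ex \1_A = fine (P A).
Proof. by move=> mA; rewrite /Ex /Rintegral integral_indic // setIT. Qed.

Lemma int_eq_Ex A X : measurable A -> L1 X ->
  (\int[P]_(w in A) (X w)%:E)%E = (Ex (fun w => \1_A w * X w))%:E.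
Proof.
move=> mA iX; have := integrable_fin_num measurableT (L1_indicM mA iX).
rewrite /Ex /Rintegral => h; rewrite fineK // [LHS]integral_mkcond.
apply: eq_integral => w _; rewrite /patch indicE /=.
by case: ifP => _; rewrite ?mul1r ?mul0r.
Qed.

Lemma Ex_norm_eq0 X : L1 X -> Ex (fun w => `|X w|) = 0 -> {ae P, forall w, X w = 0}.
Proof.
move=> iX h; have mX := L1_measurable iX.
have : (\int[P]_w `|(X w)%:E|)%E = 0%E.
  have := integrable_fin_num measurableT (L1_norm iX).
  by move=> /fineK /= <-; congr EFin; exact: h.
move/(ae_eq_integral_abs P measurableT) => H.
have {}H := H (proj2 (measurable_EFinP _ _) mX).
by apply: filterS H => w /(_ I) [].
Qed.

(** Dominated convergence, with [|W|] as the dominating function, along the events where [g] is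
    bounded by [K]. Signs of expectations can thus be checked under bounded weights. *)
Lemma trunc_ge0 W (g : T -> R) : L1 W -> measurable_fun setT g ->
  (forall K : nat, 0 <= Ex (fun w => \1_[set u | `|g u| <= K%:R] w * W w)) -> 0 <= Ex W.
Proof.
move=> iW mg hK.
have mK (K : nat) : measurable [set u | `|g u| <= K%:R].
  have -> : [set u | `|g u| <= K%:R] = setT `&` g @^-1` `[- K%:R, K%:R]%classic.
    by rewrite setTI; apply/seteqP; split => w /=; rewrite in_itv /= ler_norml.
  exact: mg.
pose F (K : nat) := EFin \o (fun w => \1_[set u | `|g u| <= K%:R] w * W w).
have [|||||_ _ hc] := @dominated_convergence _ T R P setT measurableT F (EFin \o W)
    (EFin \o (fun w => `|W w|)).
- by move=> n; have /measurable_int := L1_indicM (mK n) iW.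
- exact: measurable_int iW.
- apply: aeW => w _; apply: cvg_near_cst.
  near=> K; rewrite /F /= indicE mem_set ?mul1r //=.
  near: K; exact: nbhs_infty_ger.
- exact: L1_norm.
- by apply: aeW => w n _; rewrite /F /= lee_fin normrM ler_piMl // indic_norm_le1.
rewrite /Ex /Rintegral fine_ge0 //.
apply: (cvge_ge _ hc); apply: nearW => n /=.
have := hK n; rewrite /Ex /Rintegral => /=.
rewrite -lee_fin fineK //.
by have := integrable_fin_num measurableT (L1_indicM (mK n) iW).
Unshelve. all: by end_near. Qed.

(** Preimage form, as in [cond_exp_version], with [S] a generating family. [gmeasP] turns it into
    ordinary measurability on the space re-equipped with the generated sigma-algebra. *)
Definition gmeas (S : set (set T)) Z := forall B : set R, measurable B -> <<s S >> (Z @^-1` B).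

Lemma gmeasP S Z : gmeas S Z <-> measurable_fun setT (Z : g_sigma_algebraType S -> R).
Proof.
split=> [h _ B mB|h B mB]; first by rewrite setTI; exact: h.
by have := h measurableT B mB; rewrite setTI.
Qed.

Lemma gmeas_measurable S Z : S `<=` measurable -> gmeas S Z -> measurable_fun setT Z.
Proof.
move=> Sm h _ B mB; rewrite setTI.
by apply: smallest_sub (h B mB) => //; exact: sigma_algebra_measurable.
Qed.

Lemma gsigma_measurable S A : S `<=` measurable -> <<s S >> A -> measurable A.
Proof. by move=> Sm; apply: smallest_sub => //; exact: sigma_algebra_measurable. Qed.

(** The sum counts the integers between 1 and [n] that are at most [x], so for [x < n] it is the
    floor of [x]. It provides the staircase of [orth_bounded]. *)
Lemma count_floor (n : nat) (x : R) : 0 <= x ->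
  (n%:R <= x -> \sum_(k < n) (k.+1%:R <= x)%R%:R = n%:R :> R) /\
  (x < n%:R -> `|x - \sum_(k < n) (k.+1%:R <= x)%R%:R| <= 1).
Proof.
move=> x0; elim: n => [|n [IH1 IH2]]; first by split; rewrite big_ord0 // ltNge x0.
rewrite big_ord_recr /=; split=> [nx|xn].
  rewrite nx IH1 ?natr1 //; apply: le_trans nx; by rewrite ler_nat.
rewrite [n.+1%:R <= x]leNgt xn /= addr0; case: (ltP x n%:R) => [/IH2 //|nx].
by rewrite IH1 // ger0_norm ?subr_ge0 // lerBlDr addrC natr1 ltW.
Qed.

(** [Z + K] is nonnegative and uniformly within [s^-1] of a staircase, a combination of indicators
    of events of the sigma-algebra. The staircase contributes 0, so the expectation is at most
    [s^-1] times that of [|X|], for every [s]. *)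
Lemma orth_bounded S X Z K : S `<=` measurable -> L1 X ->
  (forall A, <<s S >> A -> Ex (fun w => \1_A w * X w) = 0) ->
  gmeas S Z -> (forall w, `|Z w| <= K) -> Ex (fun w => Z w * X w) = 0.
Proof.
move=> Sm iX hA gZ ZK; have mZ := gmeas_measurable Sm gZ.
have ZKw w : 0 <= Z w + K by have := ZK w; rewrite ler_norml; lra.
have K0 : 0 <= K by apply: le_trans (ZK point).
have EX0 : Ex X = 0.
  rewrite -(hA _ (@measurableT _ (g_sigma_algebraType S))).
  by apply: Ex_ext => w; rewrite indicT mul1r.
have EZK : Ex (fun w => Z w * X w) = Ex (fun w => (Z w + K) * X w).
  rewrite (Ex_ext (fun w => mulrDl (Z w) K (X w))) ExD; last 2 first.
  - exact: L1M_bounded ZK iX.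
  - exact: L1Z.
  by rewrite ExZ // EX0 mulr0 addr0.
suff bound (s : R) : 0 < s -> `|Ex (fun w => Z w * X w)| <= s^-1 * Ex (fun w => `|X w|).
  apply/eqP; rewrite -normr_le0; apply/ler_addgt0Pl => e e0; rewrite addr0.
  have E0 : 0 <= Ex (fun w => `|X w|) by exact: Ex_ge0.
  (* The added 1 keeps [s] positive when [X] vanishes almost surely. *)
  apply: le_trans (bound (e^-1 * (Ex (fun w => `|X w|) + 1)) _) _.
    by rewrite mulr_gt0 ?invr_gt0 //; lra.
  rewrite invfM invrK -mulrA ler_piMr ?(ltW e0) // mulrC ler_pdivrMr; lra.
move=> s0.
have [n hn] : exists n : nat, (K + K) * s < n%:R.
  by exists (Num.bound ((K + K) * s)); apply: archi_boundP; rewrite mulr_ge0 ?(ltW s0) //; lra.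
pose A k := [set w | k.+1%:R <= (Z w + K) * s].
have gA k : <<s S >> (A k).
  have -> : A k = Z @^-1` `[k.+1%:R / s - K, +oo[%classic.
    apply/seteqP; split => w; rewrite /A /= in_itv /= andbT lerBlDr ler_pdivrMr //.
  exact: gZ.
have mA k : measurable (A k) by exact: gsigma_measurable (gA k).
pose c w : R := \sum_(k < n) \1_(A k) w.
have Ec : Ex (fun w => s^-1 * (c w * X w)) = 0.
  have hL k : L1 (fun w => \1_(A k) w * X w) by exact: L1_indicM.
  have hc : (fun w => c w * X w) =1 (fun w => \sum_(k < n) \1_(A k) w * X w).
    by move=> w; rewrite /c mulr_suml.
  rewrite ExZ; last by apply: L1_ext (fun w => esym (hc w)); apply: L1_sum.
  by rewrite (Ex_ext hc) Ex_sum // big1 ?mulr0 // => k _; exact: hA.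
have iZK : L1 (fun w => (Z w + K) * X w).
  apply: (@L1M_bounded _ _ (K + K)) => //; first exact: measurable_funD.
  by move=> w; have := ZK w; rewrite !ler_norml; lra.
have icX : L1 (fun w => s^-1 * (c w * X w)).
  apply: L1Z; have -> : (fun w => c w * X w) = (fun w => \sum_(k < n) \1_(A k) w * X w).
    by apply/funext => w; rewrite /c mulr_suml.
  by apply: L1_sum => k; exact: L1_indicM.
rewrite EZK -[X in `|X|]subr0 -{1}Ec -ExB //.
apply: le_trans (Ex_norm_le (L1B iZK icX)) _.
rewrite -ExZ; last exact: L1_norm.
apply: Ex_le; [exact: L1_norm (L1B iZK icX)|exact: L1Z (L1_norm iX)|apply: aeW => w].
rewrite mulrA -mulrBl normrM ler_wpM2r //.
have -> : Z w + K - s^-1 * c w = s^-1 * ((Z w + K) * s - c w).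
  by rewrite mulrBr mulrCA mulVf ?gt_eqF // mulr1.
rewrite normrM ger0_norm ?invr_ge0 ?(ltW s0) // ler_piMr ?invr_ge0 ?(ltW s0) //.
have [_ h] := @count_floor n ((Z w + K) * s) (mulr_ge0 (ZKw w) (ltW s0)).
have -> : c w = \sum_(k < n) (k.+1%:R <= (Z w + K) * s)%R%:R.
  by apply: eq_bigr => k _; rewrite indicE /A; congr ((_ : bool)%:R); apply/idP/idP;
    rewrite inE.
apply: h; apply: le_lt_trans hn; rewrite ler_wpM2r ?(ltW s0) //.
by have := ZK w; rewrite ler_norml; lra.
Qed.

Lemma gmeasM S Z W : gmeas S Z -> gmeas S W -> gmeas S (fun w => Z w * W w).
Proof. by move=> /gmeasP h1 /gmeasP h2; apply/gmeasP; exact: measurable_funM. Qed.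

Lemma gmeas_indic S A : <<s S >> A -> gmeas S \1_A.
Proof. by move=> h; apply/gmeasP; exact: measurable_indic. Qed.

Lemma gmeas_norm_le S Z (K : R) : gmeas S Z -> <<s S >> [set w | `|Z w| <= K].
Proof.
move=> h; have -> : [set w | `|Z w| <= K] = Z @^-1` `[- K, K]%classic.
  by apply/seteqP; split => w /=; rewrite in_itv /= ler_norml.
exact: h.
Qed.

(** Truncating at [|Z| <= K] gives a bounded measurable weight, for which the expectation is 0;
    [trunc_ge0] applied to the product and to its opposite gives both inequalities. *)
Lemma orth S X Z : S `<=` measurable -> L1 X ->
  (forall A, <<s S >> A -> Ex (fun w => \1_A w * X w) = 0) ->
  gmeas S Z -> L1 (fun w => Z w * X w) -> Ex (fun w => Z w * X w) = 0.
Proof.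
move=> Sm iX hA gZ iZX; have mZ := gmeas_measurable Sm gZ.
have key (K : nat) : Ex (fun w => \1_[set u | `|Z u| <= K%:R] w * (Z w * X w)) = 0.
  rewrite (Ex_ext (fun w => mulrA _ _ _)).
  apply: (@orth_bounded S _ _ K%:R) => //.
    by apply: gmeasM => //; apply: gmeas_indic; exact: gmeas_norm_le.
  move=> w; rewrite indicE; case: (boolP (w \in _)) => [|_]; last by rewrite mul0r normr0.
  by rewrite inE /= mul1r.
apply/eqP; rewrite eq_le; apply/andP; split.
  rewrite -oppr_ge0 -mulN1r -ExZ //; apply: (@trunc_ge0 _ Z) => //; first exact: L1Z.
  move=> K; rewrite (Ex_ext (Y := fun w => -1 * (\1_[set u | `|Z u| <= K%:R] w * (Z w * X w)))).
    rewrite ExZ ?key ?mulr0 //; apply: L1_indicM => //.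
    by apply: (gsigma_measurable Sm); exact: gmeas_norm_le.
  by move=> w; ring.
by apply: (@trunc_ge0 _ Z) => // K; rewrite key.
Qed.

End Expectation.

(** * A maximal inequality for almost supermartingales *)

Lemma series_tail_small {R : realType} (b : R^nat) : (forall n, 0 <= b n) -> cvgn (series b) ->
  forall e, 0 < e -> exists n0, forall n K, (n0 <= n <= K)%N -> \sum_(n <= k < K) b k < e.
Proof.
move=> b0 cb e e0.
have nd : nondecreasing_seq (series b).
  by apply/nondecreasing_seqP => n; rewrite /series /= big_nat_recr //= lerDl.
have le_lim := nondecreasing_cvgn_le nd cb.
have [n0 _ h] : \forall n \near \oo, `|limn (series b) - series b n| < e.
  by move/cvgrPdist_lt : cb; apply.
exists n0 => n K /andP[n0n nK].
have := h n n0n; have := le_lim K.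
rewrite /= -(sub_series_geq _ nK) ltr_norml; lra.
Qed.

Section Supermartingale.
Context {d : measure_display} {T : measurableType d} {R : realType} (P : probability T R).
Variables (S : nat -> set (set T)) (z : nat -> T -> R) (p b : nat -> R) (m0 : nat).
Hypotheses (Sm : forall n, S n `<=` measurable) (Smono : forall n, S n `<=` S n.+1)
  (z0 : forall n w, 0 <= z n w) (iz : forall n, L1 P (z n)) (gz : forall n, gmeas (S n) (z n))
  (p0 : forall n, 0 <= p n) (b0 : forall n, 0 <= b n)
  (pdiv : series p @ \oo --> +oo) (bsum : cvgn (series b))
  (step : forall n B, (m0 <= n)%N -> <<s S n >> B ->
     Ex P (fun w => \1_B w * z n.+1 w) <= (1 - p n) * Ex P (fun w => \1_B w * z n w) + b n).

Let Ez n := Ex P (z n).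

Let Ez0 n : 0 <= Ez n. Proof. exact: Ex_ge0. Qed.

Let EzS n : (m0 <= n)%N -> Ez n.+1 <= (1 - p n) * Ez n + b n.
Proof.
move=> mn; have := step mn (@measurableT _ (g_sigma_algebraType (S n))).
have E X : Ex P (fun w => \1_setT w * X w) = Ex P X.
  by apply: Ex_ext => w; rewrite indicT mul1r.
by rewrite !E.
Qed.

Let small_index eta : 0 < eta -> exists n, [/\ (m0 <= n)%N, Ez n < eta &
  forall K, (n <= K)%N -> \sum_(n <= k < K) b k < eta].
Proof.
move=> eta0; have [n1 hn1] := series_tail_small b0 bsum eta0.
pose n2 := maxn m0 n1.
suff [n [n2n zn]] : exists n, (n2 <= n)%N /\ Ez n < eta.
  exists n; split => //; first by apply: leq_trans n2n; exact: leq_maxl.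
  by move=> K nK; apply: hn1; rewrite nK (leq_trans _ n2n) // leq_maxr.
apply: contrapT => /forallNP h.
have {}h n : (n2 <= n)%N -> eta <= Ez n.
  by move=> n2n; rewrite leNgt; apply/negP => zn; apply: (h n).
(* As long as the expectation stays above [eta], step [k] loses at least [eta * p k] and regains at
   most [b k]. *)
have bound j : eta * \sum_(n2 <= k < n2 + j) p k + Ez (n2 + j)%N <=
    Ez n2 + \sum_(n2 <= k < n2 + j) b k.
  elim: j => [|j IH]; first by rewrite addn0 !big_geq // mulr0; lra.
  rewrite addnS !big_nat_recr ?leq_addr //=.
  have := @EzS (n2 + j)%N (leq_trans (leq_maxl _ _) (leq_addr _ _)).
  have : eta * p (n2 + j)%N <= p (n2 + j)%N * Ez (n2 + j)%N.
    by rewrite mulrC ler_wpM2l // h // leq_addr.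
  by rewrite mulrDr; lra.
have /cvgryPge/(_ (series p n2 + (Ez n2 + eta) / eta + 1)) [K _ hK] := pdiv.
have /= hge := hK (n2 + K)%N (leq_addl _ _).
have hb := hn1 n2 (n2 + K)%N; rewrite leq_addr leq_maxr in hb; have {}hb := hb isT.
have hle := bound K; rewrite -(sub_series_geq p (leq_addr K n2)) in hle.
have h0 := Ez0 (n2 + K)%N.
have : eta * (series p (n2 + K)%N - series p n2) < Ez n2 + eta by lra.
rewrite mulrC -ltr_pdivlMr //; lra.
Qed.

(** The times are [n] to [n + j - 1], so [below eps n j.+1] is decided at time [n + j] and is an
    admissible event in [step] at that time. *)
Let below (eps : R) (n j : nat) : set T :=
  [set w | forall k, (n <= k < n + j)%N -> z k w < eps].

Let below0 eps n : below eps n 0 = setT.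
Proof.
apply/seteqP; split => // w _ k; rewrite addn0 => /andP[nk /(leq_ltn_trans nk)].
by rewrite ltnn.
Qed.

Let belowS eps n j : below eps n j.+1 = below eps n j `&` [set w | z (n + j)%N w < eps].
Proof.
apply/seteqP; split => w; rewrite /below /=.
  move=> h; split; last by apply: h; rewrite leq_addr addnS ltnS leqnn.
  by move=> k /andP[nk kj]; apply: h; rewrite nk addnS ltnS ltnW.
move=> [h1 h2] k /andP[nk]; rewrite addnS ltnS leq_eqVlt => /orP[/eqP -> //|kj].
by apply: h1; rewrite nk.
Qed.

Let lt_gmeas n eps : <<s S n >> [set w | z n w < eps].
Proof.
have -> : [set w | z n w < eps] = z n @^-1` `]-oo, eps[%classic.
  by apply/seteqP; split => w /=; rewrite in_itv.
exact: gz.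
Qed.

Let gmono n A : <<s S n >> A -> <<s S n.+1 >> A.
Proof. by apply: sub_smallest2r => //; exact: smallest_sigma_algebra. Qed.

Let below_gmeas eps n j : <<s S (n + j)%N >> (below eps n j.+1).
Proof.
elim: j => [|j IH].
  by rewrite belowS addn0 below0 setTI; exact: lt_gmeas.
rewrite belowS; apply: (@measurableI _ (g_sigma_algebraType (S (n + j.+1)%N))).
  by rewrite addnS; apply: gmono.
exact: lt_gmeas.
Qed.

Let mbelow eps n j : measurable (below eps n j).
Proof.
case: j => [|j]; last exact: gsigma_measurable (@Sm (n + j)%N) (@below_gmeas eps n j).
by rewrite below0.
Qed.

(** Stopping at the first passage above [eps]: on the part of [below] lost at time [n + j] the
    process is at least [eps], which pays for the growth of the complement. Of the contraction only
    [0 <= p] is used. *)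
Let maximal eps n j : (m0 <= n)%N -> 0 < eps ->
  Ex P (fun w => \1_(below eps n j) w * z (n + j)%N w) +
  eps * Ex P (fun w => \1_(~` below eps n j) w) <= Ez n + \sum_(n <= k < n + j) b k.
Proof.
move=> m0n eps0; elim: j => [|j IH].
  rewrite addn0 big_geq // addr0 below0.
  have -> : Ex P (fun w => \1_(~` [set: T]) w) = 0.
    by rewrite -[RHS](Ex_cst P); apply: Ex_ext => w; rewrite setCT indic0.
  rewrite mulr0 addr0.
  by rewrite le_eqVlt; apply/orP; left; apply/eqP; apply: Ex_ext => w; rewrite indicT mul1r.
have m0j : (m0 <= n + j)%N by rewrite (leq_trans m0n) // leq_addr.
rewrite addnS big_nat_recr ?leq_addr //= addrA.
have hs := step m0j (@below_gmeas eps n j).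
set B' := below eps n j.+1 in hs *; set B := below eps n j in IH *.
have mB : measurable B by exact: mbelow.
have mB' : measurable B' by exact: mbelow.
have E0 : 0 <= p (n + j)%N * Ex P (fun w => \1_B' w * z (n + j)%N w).
  by rewrite mulr_ge0 //; apply: Ex_ge0 => w; rewrite mulr_ge0.
suff : Ex P (fun w => \1_B' w * z (n + j)%N w) + eps * Ex P (fun w => \1_(~` B') w) <=
   Ex P (fun w => \1_B w * z (n + j)%N w) + eps * Ex P (fun w => \1_(~` B) w) by lra.
have iI (A : set T) : measurable A -> L1 P (fun w => \1_A w).
  by move=> mA; apply: L1_ext (L1_indicM mA (L1_cst P 1)) _ => w; rewrite mulr1.
rewrite -!ExZ -?ExD; try by [apply: L1_indicM | apply: L1Z; apply: iI; exact: measurableC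
  | apply: iI; exact: measurableC].
apply: Ex_le; try by apply: L1D; [apply: L1_indicM | apply: L1Z; apply: iI; exact: measurableC].
apply: aeW => w; rewrite /B' belowS -/B !indicE !in_setC in_setI.
case: (w \in B) => /=; last by rewrite !mul0r.
case: (boolP (w \in _)); rewrite ?mul1r ?mul0r ?mulr0 ?mulr1 //= addr0 add0r => /negP.
by rewrite inE /= => /negP; rewrite -leNgt.
Qed.

Lemma almost_supermartingale_cvg0 : {ae P, forall w, z^~ w @ \oo --> 0}.
Proof.
(* [N j] is the limit superior of the exceedance events at level 1/(j+1); convergence can fail only
   on the countable union of these sets. *)
pose N j := \bigcap_(n in setT) \bigcup_(k in [set k | (n <= k)%N]) [set w | j.+1%:R^-1 <= z k w].
have mge (e : R) k : measurable [set w | e <= z k w].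
  rewrite (_ : mkset _ = ~` [set w | z k w < e]); first apply: measurableC.
    exact: gsigma_measurable (@Sm k) (@lt_gmeas k e).
  by apply/seteqP; split => w /=; rewrite leNgt => /negP.
have N0 j : P.-negligible (N j).
  have mN : measurable (N j).
    by apply: bigcap_measurable => // n _; apply: bigcup_measurable.
  apply/negligibleP => //; apply/eqP; rewrite eq_le measure_ge0 andbT.
  pose eps : R := j.+1%:R^-1.
  have eps0 : 0 < eps by rewrite invr_gt0.
  apply/lee_addgt0Pr => e e0; rewrite add0e.
  (* One half for the expectation at time [n], one half for the tail of [b]; dividing by [eps]
     leaves probability at most [e]. *)
  have [|n [m0n zn bn]] := @small_index (eps * e / 2); first by rewrite !mulr_gt0 ?invr_gt0.
  pose C i := ~` below eps n i.
  have mC i : measurable (C i) by exact: measurableC.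
  have CP i : (P (C i) <= e%:E)%E.
    have := @maximal eps n i m0n eps0; have := bn (n + i)%N (leq_addr _ _) => hb hm.
    have E0 : 0 <= Ex P (fun w => \1_(below eps n i) w * z (n + i)%N w).
      by apply: Ex_ge0 => w; rewrite mulr_ge0.
    have : eps * Ex P (fun w => \1_(~` below eps n i) w) <= eps * e by lra.
    rewrite ler_pM2l // => h.
    by rewrite -(fineK (fin_num_measure P (C i) (mC i))) lee_fin -Ex_indic.
  have ndC : nondecreasing_seq C.
    apply/nondecreasing_seqP => i; apply/subsetPset; rewrite /C belowS.
    by apply: subsetC => w [].
  have hc := nondecreasing_cvg_mu mC (bigcupT_measurable C mC) ndC.
  apply: (@le_trans _ _ (P (\bigcup_i C i))).
    apply: le_measure; rewrite ?inE //; first exact: bigcupT_measurable.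
    move=> w /(_ n I)[k /= nk hk]; exists (k - n).+1 => //.
    rewrite /C /below /= => /(_ k); rewrite nk addnS subnKC // ltnSn => /(_ isT).
    by rewrite ltNge hk.
  by apply: (cvge_le _ (hc R P)); exact: nearW.
apply: negligibleS (negligible_bigcup N0) => w /= hw.
apply: contrapT => hN; apply: hw.
apply/cvgrPdist_lt => e e0.
have [i hi] : exists i : nat, i.+1%:R^-1 < e.
  by exists (Num.truncn e^-1); rewrite invf_plt ?posrE // truncnS_gt.
have : ~ N i w by move=> Niw; apply: hN; exists i.
move=> /existsNP[n /not_implyP[_ hn]].
exists n => // k /= nk; rewrite sub0r normrN ger0_norm //.
apply: lt_trans hi; rewrite ltNge; apply/negP => hk; apply: hn.
by exists k.
Qed.

End Supermartingale.

(** * Step sizes along blocks *)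

Section Sequences.
Context {R : realType}.
Implicit Types (u v : R^nat).

Lemma series_nondecreasing u : (forall n, 0 <= u n) -> nondecreasing_seq (series u).
Proof.
move=> u0; apply/nondecreasing_seqP => n.
by rewrite /series /= big_nat_recr //= lerDl.
Qed.

Lemma near_series_le_cvg u v : (forall n, 0 <= u n) -> (forall n, 0 <= v n) ->
  (\forall n \near \oo, u n <= v n) -> cvgn (series v) -> cvgn (series u).
Proof.
move=> u0 v0 [n0 _ uv] cv.
apply: nondecreasing_is_cvgn; first exact: series_nondecreasing.
exists (series u n0 + limn (series v)) => _ [n _ <-].
apply: le_trans (_ : series u n0 + series v n <= _); last first.
  by rewrite lerD2l; apply: nondecreasing_cvgn_le => //; exact: series_nondecreasing.
elim: n => [|n IH]; first by rewrite /series /= [\sum_(0 <= k < 0) _]big_geq //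
  [\sum_(0 <= k < 0) _]big_geq // addr0 sumr_ge0.
case: (leqP n0 n) => [n0n|nn0].
  rewrite ![series _ n.+1]/series /= !big_nat_recr //=.
  by have := uv n n0n; move: IH; rewrite /series /=; lra.
apply: le_trans (series_nondecreasing u0 nn0) _.
by rewrite lerDl /series /= sumr_ge0.
Qed.

Lemma series_block u (h n : nat) :
  series (fun m => \sum_(k < h) u (m * h + k)%N) n = series u (n * h)%N.
Proof.
elim: n => [|n IH]; first by rewrite mul0n /series /= !big_geq.
rewrite {1}/series /= big_nat_recr //= [X in X + _]IH /series /= mulSn addnC.
rewrite [RHS](big_cat_nat (n := n * h)) ?leq_addr //=; congr (_ + _).
rewrite -[X in \sum_(X <= _ < _) _]add0n big_addn addKn big_mkord.
by apply: eq_bigr => k _; rewrite addnC.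
Qed.

Lemma cvg_series_block u (h : nat) : (0 < h)%N -> (forall n, 0 <= u n) -> cvgn (series u) ->
  cvgn (series (fun m => \sum_(k < h) u (m * h + k)%N)).
Proof.
move=> h0 u0 cu; have nd := series_nondecreasing u0.
apply: nondecreasing_is_cvgn; first by apply: series_nondecreasing => n; exact: sumr_ge0.
exists (limn (series u)) => _ [n _ <-].
by rewrite series_block; exact: nondecreasing_cvgn_le.
Qed.

(** Bernoulli's inequality for exponents below 1, obtained from Young's inequality with exponents
    1/r and 1/(1-r) for the product of y^r and 1. *)
Lemma powR_le_affine (y r : R) : 0 <= y -> 0 <= r < 1 -> y `^ r <= 1 + r * (y - 1).
Proof.
move=> y0 /andP[]; rewrite le_eqVlt => /predU1P[<- _|r0 r1].
  by rewrite powRr0 mul0r addr0.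
have r1' : 0 < (1 - r)^-1 by rewrite invr_gt0 subr_gt0.
have := @conjugate_powR _ (y `^ r) 1 r^-1 (1 - r)^-1 (powR_ge0 _ _) ler01.
rewrite invr_gt0 !invrK => /(_ r0 r1'); rewrite addrC subrK => /(_ erefl).
by rewrite mulr1 -powRrM divff ?gt_eqF // powRr1 // powR1; lra.
Qed.

Lemma powR_le_double (x y r : R) : 0 <= r <= 1 -> 0 < x -> 0 < y -> x <= 2 * y ->
  x `^ r <= 2 * y `^ r.
Proof.
move=> /andP[r0 r1] x0 y0 xy; apply: le_trans (_ : (2 * y) `^ r <= _).
  by apply: ge0_ler_powR; rewrite ?nnegrE // ?ltW // mulr_gt0.
rewrite powRM ?(ltW y0) // ler_wpM2r ?powR_ge0 //.
by apply: ler1_powR; [rewrite ler1n | exact: r1].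
Qed.

End Sequences.

Section StepSizes.
Context {R : realType} {I : finType}.
Variables (alpha f : nat -> R) (alp : I -> nat -> R) (alpha0 delta lambda : R) (h : nat).
Hypotheses (delta0 : 0 <= delta) (delta2 : delta < 2^-1) (alpha_gt0 : forall t, 0 < alpha t)
  (alp_alpha : forall i, (fun t => alp i t / alpha t) @ \oo --> (1 : R))
  (alpha_cvg0 : alpha @ \oo --> (0 : R)) (alpha_div : series alpha @ \oo --> +oo)
  (alpha0_ge0 : 0 <= alpha0)
  (alpha_inv : (fun t => (alpha t.+1)^-1 - (alpha t)^-1) @ \oo --> alpha0)
  (alpha_sum : cvgn [series alpha t `^ (2 * (1 - delta))]_t)
  (h_gt0 : (0 < h)%N) (lambda_gt0 : 0 < lambda)
  (f_ge0 : forall t, 0 <= f t)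
  (f_small : (fun t => f t / alpha t `^ delta) @ \oo --> (0 : R))
  (f_sum : cvgn [series alpha t `^ (1 - delta) * f t]_t).

Let p m := alpha (m * h)%N.
Let F m := \sum_(k < h) f (m * h + k)%N.
Let mu := lambda + h%:R * alpha0 * delta.

Let delta1 : delta <= 1. Proof. by have := delta2; lra. Qed.

Lemma near_block (Q : nat -> Prop) : (\forall t \near \oo, Q t) ->
  \forall m \near \oo, forall k, Q (m * h + k)%N.
Proof.
move=> [n0 _ hQ]; exists n0 => // m /= n0m k; apply: hQ => /=.
by rewrite (leq_trans n0m) // (leq_trans (leq_pmulr m h_gt0)) // leq_addr.
Qed.

(** One step satisfies alpha(t)/alpha(t+1) = 1 + alpha(t) (1/alpha(t+1) - 1/alpha(t)), where the
    bracket converges and alpha tends to 0; [k] steps give a product of such ratios. *)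
Lemma alpha_shift k : (fun t => alpha (t + k)%N / alpha t) @ \oo --> (1 : R).
Proof.
elim: k => [|k IH].
  apply: cvg_near_cst; apply: nearW => t; rewrite addn0 divff ?gt_eqF //.
have h1 : (fun t => alpha t / alpha t.+1) @ \oo --> (1 : R).
  rewrite -[1]addr0 -[X in _ + X](mul0r alpha0).
  have -> : (fun t => alpha t / alpha t.+1) =
     (fun t => 1 + alpha t * ((alpha t.+1)^-1 - (alpha t)^-1)).
    by apply/funext => t; rewrite mulrBr divff ?gt_eqF //; ring.
  by apply: cvgD; [exact: cvg_cst|exact: cvgM].
have h2 : (fun t => alpha t.+1 / alpha t) @ \oo --> (1 : R).
  rewrite -[1]invr1; have -> : (fun t => alpha t.+1 / alpha t) =
     (fun t => (alpha t / alpha t.+1)^-1).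
    by apply/funext => t; rewrite invf_div.
  by apply: cvgV => //; rewrite oner_eq0.
have h3 : (fun t => alpha (t + k).+1 / alpha (t + k)%N) @ \oo --> (1 : R).
  by have := h2; rewrite -(cvg_shiftn k).
rewrite -[1]mulr1; have -> : (fun t => alpha (t + k.+1)%N / alpha t) =
   (fun t => (alpha (t + k).+1 / alpha (t + k)%N) * (alpha (t + k)%N / alpha t)).
  by apply/funext => t; rewrite addnS mulrA divfK ?gt_eqF.
exact: cvgM.
Qed.

Lemma near_alpha_block (e : R) : 0 < e ->
  \forall m \near \oo, forall k : 'I_h.+1, `|alpha (m * h + k)%N - p m| <= e * p m.
Proof.
move=> e0; apply: filter_forall => k.
have /cvgrPdist_le/(_ _ e0)/near_block : (fun t => alpha (t + k)%N / alpha t) @ \oo --> (1 : R).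
  exact: alpha_shift.
apply: filterS => m /(_ 0%N); rewrite addn0 -/(p m) => hk.
have pm : 0 < p m by exact: alpha_gt0.
have -> : alpha (m * h + k)%N - p m = - ((1 - alpha (m * h + k)%N / p m) * p m).
  by rewrite mulrBl divfK ?gt_eqF //; ring.
by rewrite normrN normrM (gtr0_norm pm) ler_wpM2r // ltW.
Qed.

Lemma near_alp_block (e : R) : 0 < e ->
  \forall m \near \oo, forall k : 'I_h, forall i, `|alp i (m * h + k)%N - p m| <= e * p m.
Proof.
(* Two deviations add up, [alp] from [alpha] and [alpha] from [p]. The cap at 1 gives alpha <= 2 p,
   so their sum is at most 3 e' p. *)
move=> e0; pose e' := Num.min (e / 4) 1.
have e'0 : 0 < e' by rewrite lt_min ltr01 andbT divr_gt0.
have [e'e e'1] : e' <= e / 4 /\ e' <= 1 by rewrite !ge_min !lexx orbT.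
have H1 := near_alpha_block e'0.
have H2 : \forall m \near \oo, forall i k, `|alp i (m * h + k)%N - alpha (m * h + k)%N| <=
    e' * alpha (m * h + k)%N.
  apply: filter_forall => i.
  have /cvgrPdist_le/(_ _ e'0)/near_block := alp_alpha i.
  apply: filterS => m hk k; have := hk k; set s := (_ + _)%N => {}hk.
  have -> : alp i s - alpha s = - ((1 - alp i s / alpha s) * alpha s).
    by rewrite mulrBl divfK ?gt_eqF //; ring.
  by rewrite normrN normrM (gtr0_norm (alpha_gt0 s)) ler_wpM2r // ltW.
apply: filterS2 H1 H2 => m h1 h2 k i.
have {}h1 := h1 (widen_ord (leqnSn h) k); have {}h2 := h2 i k; rewrite /= in h1.
have pm : 0 < p m by exact: alpha_gt0.
move: h1 h2; set a := alpha _; set b := alp _ _ => h1 h2.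
have pe : e' * p m <= e / 4 * p m by rewrite ler_wpM2r // ltW.
have pe1 : e' * p m <= 1 * p m by rewrite ler_wpM2r // ltW.
have a2 : a <= 2 * p m by move: h1; rewrite ler_norml; lra.
have ea : e' * a <= e' * (2 * p m) by rewrite ler_pM2l.
by move: h1 h2; rewrite !ler_norml; lra.
Qed.

Lemma block_alpha_cvg0 : p @ \oo --> (0 : R).
Proof.
apply/cvgrPdist_lt => e e0; have /cvgrPdist_lt/(_ _ e0)/near_block := alpha_cvg0.
by apply: filterS => m /(_ 0%N); rewrite addn0.
Qed.

(** Eventually the step sizes of a block sum to at most [2 * h] times the first one, so keeping one
    step size out of [h] preserves divergence. *)
Lemma block_alpha_div : series p @ \oo --> +oo.
Proof.
have [m0 _ hm] := near_alpha_block (@ltr01 R).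
have hm' m : (m0 <= m)%N -> \sum_(k < h) alpha (m * h + k)%N <= 2 * h%:R * p m.
  move=> m0m; have -> : 2 * h%:R * p m = \sum_(k < h) (2 * p m).
    by rewrite sumr_const card_ord -[RHS]mulr_natl; ring.
  apply: ler_sum => k _; have := hm m m0m (widen_ord (leqnSn h) k).
  by rewrite /= ler_norml; lra.
have h1 : 0 < 2 * h%:R :> R by rewrite mulr_gt0 // ltr0n.
have key n : series alpha (n * h)%N <= series alpha (m0 * h)%N + 2 * h%:R * series p n.
  have g0 m : 0 <= \sum_(k < h) alpha (m * h + k)%N by apply: sumr_ge0 => k _; exact: ltW.
  have p0 m : 0 <= p m by exact: (ltW (alpha_gt0 _)).
  have ser0 m : 0 <= series p m by rewrite /series /= sumr_ge0.
  rewrite -!series_block; elim: n => [|n IH].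
    apply: le_trans (series_nondecreasing g0 (leq0n m0)) _.
    by rewrite lerDl mulr_ge0 // ltW.
  case: (leqP m0 n) => [m0n|nm0].
    rewrite [series _ n.+1]/series [series p n.+1]/series /= !big_nat_recr //=.
    by have := hm' n m0n; move: IH; rewrite /series /=; lra.
  apply: le_trans (series_nondecreasing g0 nm0) _.
  by rewrite lerDl mulr_ge0 // ltW.
apply/cvgryPge => A.
have /cvgryPge/(_ (series alpha (m0 * h)%N + 2 * h%:R * A))/near_block := alpha_div.
apply: filterS => n /(_ 0%N); rewrite addn0 => hn.
by have := le_trans hn (key n); rewrite lerD2l ler_pM2l.
Qed.

Lemma block_threshold_small (e : R) : 0 < e -> \forall m \near \oo, F m <= e * p m `^ delta.
Proof.
move=> e0; pose e' := e / (2 * h%:R).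
have h0 : 0 < h%:R :> R by rewrite ltr0n.
have e'0 : 0 < e' by rewrite divr_gt0 // mulr_gt0.
have H1 := near_alpha_block (@ltr01 R).
have /cvgrPdist_le/(_ _ e'0)/near_block H2 := f_small.
apply: filterS2 H1 H2 => m h1 h2.
have -> : e * p m `^ delta = \sum_(k < h) (e' * (2 * p m `^ delta)).
  by rewrite sumr_const card_ord -[RHS]mulr_natl /e'; field; rewrite gt_eqF.
apply: ler_sum => k _.
have ak := alpha_gt0 (m * h + k)%N; have pm : 0 < p m by exact: alpha_gt0.
have := h2 k; rewrite sub0r normrN ger0_norm ?divr_ge0 ?powR_ge0 // ler_pdivrMr ?powR_gt0 //.
move=> /le_trans; apply; rewrite ler_pM2l //; apply: powR_le_double; rewrite ?delta0 ?delta1 //.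
by have := h1 (widen_ord (leqnSn h) k); rewrite /= ler_norml; lra.
Qed.

Lemma block_alpha_pow_sum : cvgn (series (fun m => p m `^ (2 * (1 - delta)))).
Proof.
have := cvg_series_block h_gt0 (fun n => powR_ge0 (alpha n) _) alpha_sum.
apply: near_series_le_cvg => [n|n|]; [exact: powR_ge0|by rewrite sumr_ge0 // => *; exact: powR_ge0|].
apply: nearW => m; rewrite (bigD1 (Ordinal h_gt0)) //= addn0 lerDl sumr_ge0 // => *.
exact: powR_ge0.
Qed.

Lemma block_threshold_sum : cvgn (series (fun m => p m `^ (1 - delta) * F m)).
Proof.
have u0 t : 0 <= alpha t `^ (1 - delta) * f t by rewrite mulr_ge0 ?powR_ge0.
apply: (@near_series_le_cvg _ _
  (fun m => 2 * \sum_(k < h) (alpha (m * h + k)%N `^ (1 - delta) * f (m * h + k)%N))) => [n|n||].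

- by rewrite mulr_ge0 ?powR_ge0 // sumr_ge0.
- by rewrite mulr_ge0 // sumr_ge0.
  have e2 : 0 < 2^-1 :> R by rewrite invr_gt0.
apply: filterS (near_alpha_block e2) => m hm.
rewrite /F mulr_sumr [leRHS]mulr_sumr; apply: ler_sum => k _.
rewrite mulrA ler_wpM2r //.
have := hm (widen_ord (leqnSn h) k); rewrite /= ler_norml => /andP[hk _].
have ak := alpha_gt0 (m * h + k)%N; have pm : 0 < p m by exact: alpha_gt0.
by apply: powR_le_double => //; have := delta0; have := delta1; lra.
exact: (@is_cvg_seriesZ _ _ (2 : R) (cvg_series_block h_gt0 u0 f_sum)).
Qed.

(** With p_m/p_(m+1) = 1 + p_m theta_m and theta_m tending to h alpha0, Bernoulli's inequality for
    the exponent 2 delta < 1 bounds the growth of the weight by 1 + 2 delta p_m (h alpha0 +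
    lambda/4). In the product the alpha0 terms cancel against those of 2 mu, and -2 lambda +
    lambda/2 + delta lambda/2 <= -lambda. The summand lambda/2 is the reserve for the block
    errors. *)
Lemma weight_ratio : \forall m \near \oo,
  p m `^ (2 * delta) <= 2 * p m.+1 `^ (2 * delta) /\
  p m `^ (2 * delta) * (1 - 2 * p m * mu + p m * (lambda / 2)) <=
    p m.+1 `^ (2 * delta) * (1 - lambda * p m).
Proof.
pose theta m := (p m.+1)^-1 - (p m)^-1.
have theta_cvg : theta @ \oo --> h%:R * alpha0.
  have tel k : (fun t => (alpha (t + k)%N)^-1 - (alpha t)^-1) @ \oo --> k%:R * alpha0.
    elim: k => [|k IH].
      by apply: cvg_near_cst; apply: nearW => t; rewrite addn0 subrr mul0r.
    have h3 : (fun t => (alpha (t + k).+1)^-1 - (alpha (t + k)%N)^-1) @ \oo --> alpha0.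
      by have := alpha_inv; rewrite -(cvg_shiftn k).
    rewrite -natr1 mulrDl mul1r.
    have -> : (fun t => (alpha (t + k.+1)%N)^-1 - (alpha t)^-1) =
      (fun t => ((alpha (t + k)%N)^-1 - (alpha t)^-1) +
         ((alpha (t + k).+1)^-1 - (alpha (t + k)%N)^-1)).
      by apply/funext => t; rewrite addnS; ring.
    exact: cvgD.
  apply/cvgrPdist_lt => e e0; have /cvgrPdist_lt/(_ _ e0)/near_block := tel h.
  by apply: filterS => m /(_ 0%N); rewrite addn0 /theta /p mulSn addnC.
have l4 : 0 < lambda / 4 by rewrite divr_gt0.
have /cvgrPdist_le/(_ _ l4) T := theta_cvg.
pose B := h%:R * alpha0 + lambda / 4.
have ha0 : 0 <= h%:R * alpha0 by rewrite mulr_ge0.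
have B0 : 0 < B by rewrite /B; lra.
have mu0 : lambda <= mu by rewrite /mu lerDl mulr_ge0.
have l0 := lambda_gt0; have d0 := delta0; have d2 := delta2.
(* Small enough that both [p m * B] and [p m * mu] are at most 1/4, hence [c] lies in [0, 1] and [r]
   stays below 2. *)
pose e := (4 * (1 + B + mu))^-1.
have den : 0 < 4 * (1 + B + mu) by lra.
have e0 : 0 < e by rewrite invr_gt0.
have /cvgrPdist_le/(_ _ e0) Psmall := block_alpha_cvg0.
apply: filterS2 T Psmall => m.
rewrite ler_distlC => /andP[_ T2]; rewrite sub0r normrN ger0_norm ?(ltW (alpha_gt0 _)) // => pe.
have pm : 0 < p m by exact: alpha_gt0.
have pm1 : 0 < p m.+1 by exact: alpha_gt0.
have pden : p m * (4 * (1 + B + mu)) <= 1 by rewrite -ler_pdivlMr // div1r.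
have pB : 0 <= p m * B by rewrite mulr_ge0 // ltW.
have pmu : p m * lambda <= p m * mu by rewrite ler_pM2l.
have plam : 0 <= p m * lambda by rewrite mulr_ge0 // ltW.
set c := 1 - 2 * p m * mu + p m * (lambda / 2).
have c0 : 0 <= c by rewrite /c; lra.
have c1 : c <= 1 by rewrite /c; lra.
have ratio : p m / p m.+1 = 1 + p m * theta m.
  by rewrite /theta mulrBr divff ?gt_eqF //; ring.
set r := (p m / p m.+1) `^ (2 * delta).
have pE : p m `^ (2 * delta) = r * p m.+1 `^ (2 * delta).
  by rewrite /r -powRM ?divr_ge0 ?(ltW pm) ?(ltW pm1) // divfK // gt_eqF.
have ptheta : p m * theta m <= p m * B by rewrite ler_pM2l // /B; lra.
have dptheta : 2 * delta * (p m * theta m) <= 2 * delta * (p m * B).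
  by rewrite ler_wpM2l //; lra.
have rB : r <= 1 + 2 * delta * (p m * B).
  apply: (@le_trans _ _ (1 + 2 * delta * (p m / p m.+1 - 1))); last by rewrite ratio; lra.
  apply: powR_le_affine; first by rewrite divr_ge0 // ltW.
  by apply/andP; split; lra.
have dpB : 2 * delta * (p m * B) <= 1 * (p m * B) by rewrite ler_wpM2r //; lra.
split.
  rewrite pE ler_wpM2r ?powR_ge0 //; lra.
rewrite pE mulrAC [leRHS]mulrC ler_wpM2r ?powR_ge0 //.
apply: (@le_trans _ _ ((1 + 2 * delta * (p m * B)) * c)); first by rewrite ler_wpM2r.
have dpBc : 2 * delta * (p m * B) * c <= 2 * delta * (p m * B).
  by rewrite ler_piMr // mulr_ge0 //; lra.
have dpl : 2 * delta * (p m * lambda) <= 1 * (p m * lambda) by rewrite ler_wpM2r //; lra.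
rewrite mulrDl mul1r; rewrite /c /B /mu in dpBc *; lra.
Qed.

(** All that is required of a block lying far enough; [eta] is fixed only after [K]. The fourth
    clause includes [k = h], the start of the next block, and needs only the fixed accuracy 1/2. *)
Definition regular_block (eta : R) (m : nat) : Prop :=
  [/\ p m <= eta, (forall (k : 'I_h) i, `|alp i (m * h + k)%N - p m| <= eta * p m),
      F m <= eta * p m `^ delta,
      (forall k : 'I_h.+1, `|alpha (m * h + k)%N - p m| <= 2^-1 * p m) &
      p m `^ (2 * delta) <= 2 * p m.+1 `^ (2 * delta) /\
      p m `^ (2 * delta) * (1 - 2 * p m * mu + p m * (lambda / 2)) <=
        p m.+1 `^ (2 * delta) * (1 - lambda * p m)].

Lemma near_regular_block (eta : R) : 0 < eta -> \forall m \near \oo, regular_block eta m.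
Proof.
move=> eta0; near=> m; split.
- near: m; have /cvgrPdist_le/(_ _ eta0) := block_alpha_cvg0.
  by apply: filterS => m; rewrite sub0r normrN ger0_norm // (ltW (alpha_gt0 _)).
- by near: m; exact: near_alp_block.
- by near: m; exact: block_threshold_small.
- by near: m; apply: near_alpha_block; rewrite invr_gt0.
- by near: m; exact: weight_ratio.
Unshelve. all: by end_near. Qed.

End StepSizes.

(** * Square-integrable random variables *)

Section SquareIntegrable.
Context {d : measure_display} {T : measurableType d} {R : realType} (P : probability T R).
Implicit Types X Y : T -> R.

Definition L2 X := measurable_fun setT X /\ L1 P (fun w => X w ^+ 2).

Lemma L1_bounded_aeM X Y C : measurable_fun setT Y -> {ae P, forall w, `|Y w| <= C} ->
  L1 P X -> L1 P (fun w => Y w * X w).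
Proof.
move=> mY YC iX; apply: (L1_le _ (L1Z C (L1_norm iX))).
  by apply: measurable_funM => //; exact: L1_measurable iX.
by apply: filterS YC => w YCw; rewrite normrM ler_wpM2r.
Qed.

Lemma L2_le X Y : measurable_fun setT X -> L2 Y -> {ae P, forall w, `|X w| <= Y w} -> L2 X.
Proof.
move=> mX [mY iY] XY; split => //; apply: (L1_le _ iY).
  by apply: measurable_funX.
apply: filterS XY => w XYw; rewrite normrX ler_sqr ?nnegrE //.
exact: le_trans XYw.
Qed.

Lemma L2M X Y : L2 X -> L2 Y -> L1 P (fun w => X w * Y w).
Proof.
move=> [mX iX] [mY iY]; apply: (L1_le _ (L1D iX iY)); first exact: measurable_funM.
apply: aeW => w; rewrite normrM -[X w ^+ 2]real_normK ?num_real //.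
rewrite -[Y w ^+ 2]real_normK ?num_real //.
have := sqr_ge0 (`|X w| - `|Y w|); have := mulr_ge0 (normr_ge0 (X w)) (normr_ge0 (Y w)).
by rewrite sqrrB; lra.
Qed.

Lemma L2D X Y : L2 X -> L2 Y -> L2 (fun w => X w + Y w).
Proof.
move=> h1 h2; have [mX iX] := h1; have [mY iY] := h2; split; first exact: measurable_funD.
by apply: (L1_ext (L1D (L1D iX (L1Z 2 (L2M h1 h2))) iY)) => w /=; ring.
Qed.

Lemma L2_cst c : L2 (fun=> c).
Proof. by split => //; exact: L1_cst. Qed.

Lemma L2Z c X : L2 X -> L2 (fun w => c * X w).
Proof.
move=> [mX iX]; split; first exact: measurable_funM.
by apply: L1_ext (L1Z (c ^+ 2) iX) _ => w; rewrite exprMn.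
Qed.

Lemma L2_norm X : L2 X -> L2 (fun w => `|X w|).
Proof.
move=> [mX iX]; split; first exact: measurableT_comp.
by apply: L1_ext iX _ => w; rewrite real_normK // num_real.
Qed.

Lemma L2_sum (K : Type) (s : seq K) (F : K -> T -> R) : (forall k, L2 (F k)) ->
  L2 (fun w => \sum_(k <- s) F k w).
Proof.
move=> h; elim: s => [|k s IH].
  by rewrite (_ : (fun _ => _) = fun=> 0); [exact: L2_cst|apply/funext => w; rewrite big_nil].
rewrite (_ : (fun _ => _) = fun w => F k w + \sum_(k <- s) F k w); first exact: L2D.
by apply/funext => w; rewrite big_cons.
Qed.

End SquareIntegrable.

(** * Almost sure convergence of the linear recursion *)

Section StochasticApproximation.
Context {d : measure_display} {T : measurableType d} {R : realType} (P : probability T R)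
  {I J : finType}.
Variables (alpha f : nat -> R) (alp : I -> nat -> R) (alpha0 delta lambda : R) (h : nat).
Let p m := alpha (m * h)%N.
Let F m := \sum_(k < h) f (m * h + k)%N.
Let mu := lambda + h%:R * alpha0 * delta.
Hypotheses (delta0 : 0 <= delta) (delta1 : delta <= 1) (alpha_gt0 : forall t, 0 < alpha t)
  (h_gt0 : (0 < h)%N) (lambda_gt0 : 0 < lambda) (f_ge0 : forall t, 0 <= f t)
  (regular : forall eta, 0 < eta ->
     \forall m \near \oo, regular_block alpha f alp alpha0 delta lambda h eta m)
  (block_alpha_div : series p @ \oo --> +oo)
  (block_alpha_pow_sum : cvgn (series (fun m => p m `^ (2 * (1 - delta)))))
  (block_threshold_sum : cvgn (series (fun m => p m `^ (1 - delta) * F m))).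

Variables (e eps : nat -> I -> T -> R) (G : nat -> I -> I -> T -> R)
  (B : nat -> I -> J -> T -> R) (V : nat -> J -> T -> R) (C cV : R) (S : nat -> set (set T)).
Let Gw t w := fun i j => G t i j w.
Let Bw t w := fun i r => B t i r w.
Let Vw t w := fun r => V t r w.
Let ew t w := fun i => e t i w.
Let epsw t w := fun i => eps t i w.
Let bounded_at w := forall t, (forall i j, `|G t i j w| <= C) /\ (forall i r, `|B t i r w| <= C).
(** [S t] generates the past strictly before [t], so [G], [B] and [V] at time [t] are assumed
    measurable but not adapted. [noise0] and [drift] are the integrated forms of the noise and
    excitation assumptions, tested on events of the block start. *)
Hypotheses (C0 : 0 <= C) (cV0 : 0 <= cV)
  (Sm : forall t, S t `<=` measurable) (Smono : forall t, S t `<=` S t.+1)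
  (ge : forall t i, gmeas (S t) (e t i))
  (mG : forall t i j, measurable_fun setT (G t i j))
  (mB : forall t i r, measurable_fun setT (B t i r))
  (V2 : forall t r, L2 P (V t r)) (EV : forall t r, Ex P (fun w => V t r w ^+ 2) <= cV)
  (e0 : forall i, L2 P (e 0%N i))
  (rec : forall t i w, e t.+1 i w =
     e t i w + alp i t * drive (Gw t w) (Bw t w) (epsw t w) (Vw t w) (ew t w) i)
  (epsC : forall t i w, `|eps t i w| <= C * f t)
  (GBC : {ae P, forall w, bounded_at w})
  (noise0 : forall m (k : 'I_h) A i r, <<s S (m * h)%N >> A ->
     Ex P (fun w => \1_A w * (e (m * h + k)%N i w * B (m * h + k)%N i r w
       * V (m * h + k)%N r w)) = 0)
  (drift : forall m A, <<s S (m * h)%N >> A ->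
     mu * Ex P (fun w => \1_A w * sqs (ew (m * h)%N w)) <=
     \sum_(k < h) Ex P (fun w => \1_A w * qform (Gw (m * h + k)%N w) (ew (m * h)%N w))).

Let me t i : measurable_fun setT (e t i).
Proof. exact: gmeas_measurable (@Sm t) (@ge t i). Qed.

(** By induction, each component is dominated almost surely by a linear expression in the previous
    errors, the threshold and the noise. This is what makes the noise and drift products
    integrable. *)
Lemma error_L2 t i : L2 P (e t i).
Proof.
elim: t i => [|t IH] i; first exact: e0.
pose Y w := \sum_j `|e t j w| + (`|alp i t| * (#|I|%:R * C)) *
  (\sum_j `|e t j w| + (f t + \sum_r `|V t r w|)).
apply: (@L2_le _ _ _ _ _ Y) => //.
  have h1 : L2 P (fun w => \sum_j `|e t j w|) by apply: L2_sum => j; exact: L2_norm.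
  apply: L2D => //; apply: L2Z; apply: L2D => //; apply: L2D; first exact: L2_cst.
  by apply: L2_sum => r; apply: L2_norm; exact: V2.
apply: filterS GBC => w /(_ t)[Gb Bb].
rewrite rec (le_trans (ler_normD _ _)) // lerD //; first exact: (le_l1 (ew t w) i).
rewrite normrM -mulrA ler_wpM2l //.
apply: le_trans (le_l1 _ i) _.
by apply: (@l1_drive R I J C (f t)) => // j; exact: epsC.
Qed.

Let N0 m w := l1 (ew (m * h)%N w).
Let Sn m w := \sum_(k < h) (f (m * h + k)%N + l1 (Vw (m * h + k)%N w)).
Let sq m w := sqs (ew (m * h)%N w).
Let Q m k w := qform (Gw (m * h + k)%N w) (ew (m * h)%N w).
Let noise m w := \sum_(k < h) \sum_i \sum_r
  (2 * alp i (m * h + k)%N) *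
  (e (m * h + k)%N i w * B (m * h + k)%N i r w * V (m * h + k)%N r w).

Let p0 m : 0 < p m. Proof. exact: alpha_gt0. Qed.
Let F0 m : 0 <= F m. Proof. by rewrite sumr_ge0. Qed.
Let N00 m w : 0 <= N0 m w. Proof. exact: l1_ge0. Qed.
Let Sn0 m w : 0 <= Sn m w.
Proof. by apply: sumr_ge0 => k _; rewrite addr_ge0 // l1_ge0. Qed.

Let gq m : p m = p m `^ delta * p m `^ (1 - delta).
Proof.
rewrite -powRD; last by apply/implyP => _; rewrite gt_eqF.
by rewrite addrC subrK powRr1 // ltW.
Qed.

Let sqrpow m r : p m `^ (2 * r) = (p m `^ r) ^+ 2.
Proof. by rewrite mulrC powRrM powR_mulrn // powR_ge0. Qed.

(** * The recursion over one block, for fixed [K] and [eta] *)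

Section Block.
Variables (K eta : R).
Hypotheses (K0 : 0 <= K) (HK : block_bound I J h C K) (eta0 : 0 < eta) (eta1 : eta <= 1)
  (etaK : 4 * K * #|I|%:R * eta <= lambda / 2).
Let good m := regular_block alpha f alp alpha0 delta lambda h eta m.

(** Four copies of p eta N0^2 have to be absorbed: two from the square of [N0 + Sn], one from the
    inexact step sizes, one from the threshold. With N0^2 at most the dimension times [sq], [etaK]
    fits them into [p m * (lambda / 2) * sq m w]. *)
Let path_step m w : good m -> bounded_at w ->
  (forall k, (k <= h)%N -> l1 (ew (m * h + k)%N w) <= N0 m w + K * p m * (N0 m w + Sn m w)) /\
  sq m.+1 w <= (1 + p m * (lambda / 2)) * sq m w - 2 * p m * (\sum_(k < h) Q m k w) + noise m w
    + 2 * K * p m ^+ 2 * Sn m w ^+ 2 + K * (p m `^ (1 - delta) * F m) * p m `^ (2 * delta).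
Proof.
move=> [pe alpe Fe _ _] bw.
have p1 : p m <= 1 by apply: le_trans pe _; exact: eta1.
have := @HK (fun t => ew (m * h + t)%N w) (fun t i => alp i (m * h + t)%N)
  (fun t => Gw (m * h + t)%N w) (fun t => Bw (m * h + t)%N w) (fun t => epsw (m * h + t)%N w)
  (fun t => Vw (m * h + t)%N w) (fun t => f (m * h + t)%N) (p m) eta.
rewrite (ltW (p0 m)) p1 (ltW eta0) eta1 => /(_ isT isT).
move=> /(_ (fun t i th => alpe (Ordinal th) i)).
move=> /(_ (fun t i j _ => (bw (m * h + t)%N).1 i j) (fun t i r _ => (bw (m * h + t)%N).2 i r)).
move=> /(_ (fun t i _ => epsC (m * h + t)%N i w) (fun t => f_ge0 _)).
move=> /(_ _)[t i _|]; first by rewrite addnS; exact: rec.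
rewrite addn0 -/(N0 m w) -/(Sn m w) -/(F m) => Hl1 Hsq; split => //.
have -> : sq m.+1 w = sqs (ew (m * h + h)%N w) by rewrite /sq mulSn addnC.
apply: le_trans Hsq _.
have -> : \sum_(t < h) \sum_i \sum_r 2 * (alp i (m * h + t)%N * ew (m * h + t)%N w i
    * Bw (m * h + t)%N w i r) * Vw (m * h + t)%N w r = noise m w.
  by do 3 (apply: eq_bigr => ? _); rewrite /ew /Bw /Vw; ring.
rewrite -/(sq m w) -/(Q m _ w).
have n0 : N0 m w ^+ 2 <= #|I|%:R * sq m w by exact: l1_sqr_le.
have pN : p m * N0 m w <= p m `^ (1 - delta) * (p m `^ (2 * delta) + N0 m w ^+ 2).
  rewrite {1}gq [_ `^ delta * _]mulrC -mulrA ler_wpM2l ?powR_ge0 // sqrpow.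
  have := sqr_ge0 (p m `^ delta - N0 m w); have := mulr_ge0 (powR_ge0 (p m) delta) (N00 m w).
  by rewrite sqrrB; lra.
have pFeta : p m `^ (1 - delta) * F m <= p m * eta.
  apply: le_trans (ler_wpM2l (powR_ge0 _ _) Fe) _.
  by rewrite [X in _ <= X * _]gq; rewrite le_eqVlt; apply/orP; left; apply/eqP; ring.
have pFN : p m * F m * N0 m w <= p m * eta * N0 m w ^+ 2 +
     p m `^ (1 - delta) * F m * p m `^ (2 * delta).
  have := ler_wpM2r (F0 m) pN; have := ler_wpM2r (sqr_ge0 (N0 m w)) pFeta; lra.
have pp : p m ^+ 2 * (N0 m w + Sn m w) ^+ 2 <=
    2 * (p m * eta * N0 m w ^+ 2) + 2 * (p m ^+ 2 * Sn m w ^+ 2).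
  have h1 : (N0 m w + Sn m w) ^+ 2 <= 2 * N0 m w ^+ 2 + 2 * Sn m w ^+ 2.
    by have := sqr_ge0 (N0 m w - Sn m w); rewrite sqrrB sqrrD; lra.
  have h2 : p m ^+ 2 * N0 m w ^+ 2 <= p m * eta * N0 m w ^+ 2.
    by rewrite ler_wpM2r ?sqr_ge0 // expr2 ler_wpM2l // ltW.
  by have := ler_wpM2l (sqr_ge0 (p m)) h1; lra.
have tot : K * (p m ^+ 2 * (N0 m w + Sn m w) ^+ 2 + eta * p m * N0 m w ^+ 2
     + p m * F m * N0 m w) <=
   K * (4 * (p m * eta * N0 m w ^+ 2) + 2 * (p m ^+ 2 * Sn m w ^+ 2) +
     p m `^ (1 - delta) * F m * p m `^ (2 * delta)).
  by rewrite ler_wpM2l //; lra.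
have sq0 : 0 <= sq m w by exact: sqs_ge0.
have last1 : K * (4 * (p m * eta * N0 m w ^+ 2)) <= p m * (lambda / 2) * sq m w.
  have -> : K * (4 * (p m * eta * N0 m w ^+ 2)) = p m * (4 * K * eta) * N0 m w ^+ 2 by ring.
  have h3 : 0 <= p m * (4 * K * eta).
    by rewrite mulr_ge0 ?(ltW (p0 m)) // mulr_ge0 ?(ltW eta0) // mulr_ge0.
  apply: le_trans (ler_wpM2l h3 n0) _.
  have -> : p m * (4 * K * eta) * (#|I|%:R * sq m w) =
    p m * (4 * K * #|I|%:R * eta) * sq m w by ring.
  by rewrite ler_wpM2r // ler_wpM2l // ltW.
lra.
Qed.

Let mV t r : measurable_fun setT (V t r). Proof. exact: (V2 t r).1. Qed.

Let Sn_L2 m : L2 P (Sn m).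
Proof.
apply: L2_sum => k; apply: L2D; first exact: L2_cst.
by apply: L2_sum => r; apply: L2_norm; exact: V2.
Qed.

(** [Sn] is a threshold sum at most 1 plus a sum of [h * #|J|] absolute noise entries. Squaring the
    two parts costs the factors 2, Cauchy-Schwarz one factor [h * #|J|], and summing the second
    moments the other. *)
Let cS := 2 + 2 * (h%:R * #|J|%:R) * (h%:R * #|J|%:R) * cV.

Let ESn m : good m -> Ex P (fun w => Sn m w ^+ 2) <= cS.
Proof.
move=> [pe _ Fe _ _].
have F1 : F m <= 1.
  apply: le_trans Fe _; apply: le_trans (_ : 1 * p m `^ delta <= _).
    by rewrite ler_wpM2r ?powR_ge0 //; exact: eta1.
  rewrite mul1r (_ : 1 = 1 `^ delta); last by rewrite powR1.
  apply: ge0_ler_powR; rewrite ?nnegrE //; first exact: ltW (p0 m).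
  by apply: le_trans pe _; exact: eta1.
pose W w := 2 + 2 * (h%:R * #|J|%:R) * \sum_(k < h) \sum_r V (m * h + k)%N r w ^+ 2.
have iW : L1 P W.
  apply: L1D; first exact: L1_cst.
  by apply: L1Z; apply: L1_sum => k; apply: L1_sum => r; exact: (V2 _ _).2.
apply: le_trans (_ : Ex P W <= _).
  apply: Ex_le => //; first exact: (Sn_L2 m).2.
  apply: aeW => w; rewrite /Sn big_split /= -/(F m).
  set Y := \sum_(k < h) _.
  have Y2 : Y ^+ 2 <= (h%:R * #|J|%:R) * \sum_(k < h) \sum_r V (m * h + k)%N r w ^+ 2.
    apply: le_trans (sqr_sum_le _) _; rewrite card_ord -mulrA ler_wpM2l // mulr_sumr.
    apply: ler_sum => k _; apply: le_trans (l1_sqr_le _) _.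
    by rewrite /sqs /Vw.
  have F2 : F m ^+ 2 <= 1 by rewrite expr_le1.
  by have := sqr_ge0 (F m - Y); rewrite /W sqrrB sqrrD; lra.
rewrite /W ExD; [|exact: L1_cst|]; last first.
  by apply: L1Z; apply: L1_sum => k; apply: L1_sum => r; exact: (V2 _ _).2.
rewrite Ex_cst ExZ; last by apply: L1_sum => k; apply: L1_sum => r; exact: (V2 _ _).2.
rewrite lerD2l -[leRHS]mulrA ler_wpM2l ?mulr_ge0 //.
rewrite Ex_sum; last by move=> k; apply: L1_sum => r; exact: (V2 _ _).2.
have -> : h%:R * #|J|%:R * cV = \sum_(k < h) \sum_(r : J) cV.
  by rewrite !sumr_const card_ord -mulrnA -[RHS]mulr_natl mulnC natrM.
apply: ler_sum => k _; rewrite Ex_sum; last by move=> r; exact: (V2 _ _).2.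
by apply: ler_sum => r _; exact: EV.
Qed.

Let iQ m k : L1 P (Q m k).
Proof.
apply: L1_sum => i; apply: L1_sum => j.
apply: (L1_ext (X := fun w => G (m * h + k)%N i j w * (e (m * h)%N i w * e (m * h)%N j w))).
  apply: (@L1_bounded_aeM _ _ _ _ _ _ C); [exact: mG| |by apply: L2M; exact: error_L2].
  by apply: filterS GBC => w /(_ (m * h + k)%N)[].
by move=> w; rewrite /Gw /ew mulrCA mulrA.
Qed.

Let inoise t i r : L1 P (fun w => e t i w * B t i r w * V t r w).
Proof.
apply: (L1_ext (X := fun w => B t i r w * (e t i w * V t r w))).
  apply: (@L1_bounded_aeM _ _ _ _ _ _ C); [exact: mB| |by apply: L2M => //; exact: error_L2].
  by apply: filterS GBC => w /(_ t)[].
by move=> w; ring.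
Qed.

Let isq m : L1 P (sq m).
Proof. by apply: L1_sum => i; exact: (error_L2 _ _).2. Qed.

(** [path_step] integrated over [A], term by term: [noise0] removes [X3], and [drift] turns [X2]
    into a multiple of the squared error. *)
Let block_step m A : good m -> <<s S (m * h)%N >> A ->
  Ex P (fun w => \1_A w * sq m.+1 w) <=
  (1 - 2 * p m * mu + p m * (lambda / 2)) * Ex P (fun w => \1_A w * sq m w)
  + 2 * K * p m ^+ 2 * cS + K * (p m `^ (1 - delta) * F m) * p m `^ (2 * delta).
Proof.
move=> gm sA; have mA := gsigma_measurable (@Sm _) sA.
set c1 := 1 + p m * (lambda / 2); set c2 := 2 * K * p m ^+ 2.
set c3 := K * (p m `^ (1 - delta) * F m) * p m `^ (2 * delta).
have c20 : 0 <= c2 by rewrite !mulr_ge0 // ltW.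
have c30 : 0 <= c3 by rewrite !mulr_ge0 ?powR_ge0.
pose X1 w := c1 * (\1_A w * sq m w).
pose X2 w := - (2 * p m) * \sum_(k < h) \1_A w * Q m k w.
pose X3 w := \sum_(k < h) \sum_i \sum_r (2 * alp i (m * h + k)%N) *
  (\1_A w * (e (m * h + k)%N i w * B (m * h + k)%N i r w * V (m * h + k)%N r w)).
pose X4 w := c2 * Sn m w ^+ 2.
have iX1 : L1 P X1 by apply: L1Z; exact: L1_indicM.
have iAQ k : L1 P (fun w => \1_A w * Q m k w) by exact: L1_indicM.
have iX2 : L1 P X2 by apply: L1Z; exact: L1_sum.
have iX3' k i r : L1 P (fun w => (2 * alp i (m * h + k)%N) *
   (\1_A w * (e (m * h + k)%N i w * B (m * h + k)%N i r w * V (m * h + k)%N r w))).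
  by apply: L1Z; exact: L1_indicM.
have iX3 : L1 P X3 by do 3 (apply: L1_sum => ?).
have iX4 : L1 P X4 by apply: L1Z; exact: (Sn_L2 m).2.
have EX3 : Ex P X3 = 0.
  rewrite Ex_sum; last by move=> k; do 2 (apply: L1_sum => ?).
  rewrite big1 // => k _; rewrite Ex_sum; last by move=> i; apply: L1_sum.
  rewrite big1 // => i _; rewrite Ex_sum // big1 // => r _.
  by rewrite ExZ ?noise0 ?mulr0 //; exact: L1_indicM.
have EX2 : Ex P X2 <= - (2 * p m) * (mu * Ex P (fun w => \1_A w * sq m w)).
  rewrite ExZ; last exact: L1_sum.
  rewrite !mulNr lerN2 ler_wpM2l ?mulr_ge0 ?(ltW (p0 m)) // Ex_sum //.
  exact: drift.
have EX4 : Ex P X4 <= c2 * cS by rewrite ExZ ?ler_wpM2l ?ESn //; exact: (Sn_L2 m).2.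
have EX1 : Ex P X1 = c1 * Ex P (fun w => \1_A w * sq m w) by rewrite ExZ //; exact: L1_indicM.
pose X w := X1 w + X2 w + X3 w + X4 w + c3.
have iX : L1 P X.
  by apply: L1D; last exact: L1_cst; do 3 (apply: L1D => //).
apply: le_trans (_ : Ex P X <= _); last first.
  rewrite ExD; [|by do 3 (apply: L1D => //)|exact: L1_cst].
  rewrite ExD; [|by do 2 (apply: L1D => //)|by []].
  rewrite ExD; [|by apply: L1D|by []].
  rewrite ExD // Ex_cst EX3 EX1 addr0 lerD2r.
  by rewrite /c1; lra.
apply: Ex_le => //; first exact: L1_indicM.
apply: filterS GBC => w bw; have [_ hw] := path_step gm bw.
rewrite /X /X1 /X2 /X3 /X4 -/c1 -/c2 -/c3 in hw *.
(* [X4] and [c3] carry no indicator; off [A] it suffices that they are nonnegative. *)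
rewrite !indicE; case: (w \in A) => /=; last first.
  rewrite !mul0r mulr0 big1; last by move=> *; rewrite mul0r.
  rewrite big1; last by move=> *; rewrite big1 // => *; rewrite big1 // => *; rewrite mul0r mulr0.
  by rewrite !mulr0 !add0r addr_ge0 // mulr_ge0 // sqr_ge0.
rewrite !mul1r.
under [X in _ + _ * X + _ + _ + _]eq_bigr => k _ do rewrite mul1r.
under [X in _ + X + _ + _]eq_bigr => k _.
  under eq_bigr => i _. under eq_bigr => r _ do rewrite mul1r. over. over.
rewrite -/(noise m w) mulNr; lra.
Qed.

Let cS0 : 0 <= cS.
Proof. by rewrite addr_ge0 // !mulr_ge0. Qed.

Let z m w := (p m `^ (2 * delta))^-1 * sq m w.
(** Both error terms of [block_step] contain the factor p_m^(2 delta), once p_m^2 is split. Division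
    by the next weight leaves a ratio at most 2 by [weight_ratio], whence the outer factor. *)
Let b m := 2 * (2 * K * cS * p m `^ (2 * (1 - delta)) + K * (p m `^ (1 - delta) * F m)).

Let z_step m A : good m -> <<s S (m * h)%N >> A ->
  Ex P (fun w => \1_A w * z m.+1 w) <= (1 - lambda * p m) * Ex P (fun w => \1_A w * z m w) + b m.
Proof.
move=> gm sA; have mA := gsigma_measurable (@Sm _) sA.
have Ez n : Ex P (fun w => \1_A w * z n w) =
    (p n `^ (2 * delta))^-1 * Ex P (fun w => \1_A w * sq n w).
  by rewrite -ExZ; [apply: Ex_ext => w; rewrite mulrCA|exact: L1_indicM].
rewrite !Ez; have hb := block_step gm sA.
have [_ _ _ _ [u2 uc]] := gm; rewrite -/(p m) -/(p m.+1) -/mu in u2 uc.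
set E := Ex P (fun w => \1_A w * sq m w) in hb *.
have E0 : 0 <= E by apply: Ex_ge0 => w; rewrite mulr_ge0 // sqs_ge0.
set u := p m `^ (2 * delta) in u2 uc hb *; set u' := p m.+1 `^ (2 * delta) in u2 uc *.
have u0 : 0 < u by exact: powR_gt0.
have u'0 : 0 < u' by exact: powR_gt0.
have p2 : p m ^+ 2 = u * p m `^ (2 * (1 - delta)).
  by rewrite {1}gq exprMn /u !sqrpow.
rewrite mulrC ler_pdivrMr //; apply: le_trans hb _.
have -> : ((1 - lambda * p m) * (u^-1 * E) + b m) * u' =
    (u' * (1 - lambda * p m)) * (u^-1 * E) + u' * b m by ring.
have hE : u * (1 - 2 * p m * mu + p m * (lambda / 2)) * (u^-1 * E) <=
    u' * (1 - lambda * p m) * (u^-1 * E).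
  by rewrite ler_wpM2r // mulr_ge0 // invr_ge0 ltW.
have -> : (1 - 2 * p m * mu + p m * (lambda / 2)) * E =
    u * (1 - 2 * p m * mu + p m * (lambda / 2)) * (u^-1 * E).
  by field; rewrite gt_eqF.
rewrite -addrA; apply: lerD => //.
have -> : 2 * K * p m ^+ 2 * cS + K * (p m `^ (1 - delta) * F m) * u =
   u * (2 * K * cS * p m `^ (2 * (1 - delta)) + K * (p m `^ (1 - delta) * F m)).
  by rewrite p2; ring.
rewrite /b [leRHS]mulrCA [leRHS]mulrA ler_wpM2r //.
by rewrite addr_ge0 // !mulr_ge0 ?powR_ge0.
Qed.

Hypothesis goodP : \forall m \near \oo, good m.

Let gz m : gmeas (S (m * h)%N) (z m).
Proof.
apply/gmeasP; apply: measurable_funM => //; apply: measurable_sum => i.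
by apply: measurable_funX; apply/gmeasP; exact: ge.
Qed.

Let lp_div : series (fun m => lambda * p m) @ \oo --> +oo.
Proof.
apply/cvgryPge => A; have /cvgryPge/(_ (A / lambda)) := block_alpha_div.
apply: filterS => n; rewrite ler_pdivrMr // => /le_trans; apply.
by rewrite /series /= mulr_suml; apply: ler_sum => k _; rewrite mulrC.
Qed.

Let z_cvg : {ae P, forall w, z^~ w @ \oo --> 0}.
Proof.
have [m0 _ gm0] := goodP.
apply: (@almost_supermartingale_cvg0 _ _ _ P (fun m => S (m * h)%N) z
  (fun m => lambda * p m) b m0) => //.
- move=> n; rewrite mulSn addnC.
  have mono k : S (n * h)%N `<=` S (n * h + k)%N.
    elim: k => [|k IH]; first by rewrite addn0.
    by rewrite addnS; apply: subset_trans IH _; exact: Smono.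
  exact: mono.
- by move=> n w; rewrite mulr_ge0 ?sqs_ge0 // invr_ge0 powR_ge0.
- by move=> n; apply: L1Z.
- by move=> n; rewrite mulr_ge0 // ltW.
- by move=> n; rewrite mulr_ge0 // addr_ge0 // !mulr_ge0 ?powR_ge0.
- have h1 := @is_cvg_seriesZ _ _ (2 * K * cS) block_alpha_pow_sum.
  have h2 := @is_cvg_seriesZ _ _ K block_threshold_sum.
  exact: (@is_cvg_seriesZ _ _ (2 : R) (is_cvg_seriesD h1 h2)).
- by move=> n A m0n sA; apply: z_step => //; exact: gm0.
Qed.

Hypothesis eta_lambda : lambda * eta <= 1.

(** The expectations are summable by themselves, so all measurable sets can serve as the filtration,
    and the contracted term need only be nonnegative, which [eta_lambda] ensures. The 4 is the
    square of the bound 2 on the ratio of consecutive p^(1-delta). *)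
Let Sn_cvg : {ae P, forall w, (fun m => p m `^ (2 * (1 - delta)) * Sn m w ^+ 2) @ \oo --> 0}.
Proof.
have [m0 _ gm0] := goodP.
have iSn n : L1 P (fun w => p n `^ (2 * (1 - delta)) * Sn n w ^+ 2).
  by apply: L1Z; exact: (Sn_L2 n).2.
apply: (@almost_supermartingale_cvg0 _ _ _ P (fun=> measurable)
  (fun m w => p m `^ (2 * (1 - delta)) * Sn m w ^+ 2)
  (fun m => lambda * p m) (fun m => 4 * cS * p m `^ (2 * (1 - delta))) m0) => //.
- by move=> _ A.
- by move=> _ A.
- by move=> n w; rewrite mulr_ge0 ?powR_ge0 ?sqr_ge0.
- move=> n Y mY; apply: sub_sigma_algebra.
  by have := L1_measurable (iSn n) measurableT mY; rewrite setTI.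
- by move=> n; rewrite mulr_ge0 // ltW.
- by move=> n; rewrite !mulr_ge0 ?powR_ge0.
- exact: (@is_cvg_seriesZ _ _ (4 * cS) block_alpha_pow_sum).
move=> n A m0n sA.
have mA : measurable A by apply: gsigma_measurable sA.
have gn : good n by exact: gm0.
have [pe _ _ al _] := gn.
have lp1 : lambda * p n <= 1.
  by apply: le_trans eta_lambda; rewrite ler_pM2l.
apply: (@le_trans _ _ (4 * cS * p n `^ (2 * (1 - delta)))); last first.
  rewrite lerDr mulr_ge0 ?subr_ge0 //; apply: Ex_ge0 => w.
  by rewrite mulr_ge0 // mulr_ge0 ?powR_ge0 ?sqr_ge0.
apply: (@le_trans _ _ (Ex P (fun w => p n.+1 `^ (2 * (1 - delta)) * Sn n.+1 w ^+ 2))).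
  apply: Ex_le => //; first exact: L1_indicM.
  apply: aeW => w; rewrite indicE; case: (w \in A); rewrite ?mul1r // mul0r.
  by rewrite mulr_ge0 ?powR_ge0 ?sqr_ge0.
rewrite ExZ; last exact: (Sn_L2 _).2.
have p2 : p n.+1 `^ (1 - delta) <= 2 * p n `^ (1 - delta).
  apply: powR_le_double => //; first by have := delta0; have := delta1; lra.
  have := al ord_max; rewrite /= -[X in (_ + X)%N]mul1n -mulnDl addn1 -/(p n.+1) -/(p n).
  by have := p0 n; rewrite ler_norml; lra.
rewrite mulrC [4 * cS]mulrC -mulrA ler_pM ?powR_ge0 //.
- by apply: Ex_ge0 => w; exact: sqr_ge0.
- by apply: ESn; apply: gm0; exact: leqW.
- rewrite !sqrpow (_ : 4 = 2 ^+ 2); last by ring.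
  by rewrite -exprMn ler_sqr // nnegrE ?mulr_ge0 ?powR_ge0.
Qed.

Lemma scaled_error_cvg0 :
  {ae P, forall w, forall i, (fun t => (alpha t `^ delta)^-1 * e t i w) @ \oo --> 0}.
Proof.
apply: filterS3 GBC z_cvg Sn_cvg => w bw zw sw i.
apply/cvgrPdist_lt => eps0 eps00.
(* The error inside the block is at most ((1+K)(1+|I|) + K) x p^delta, and p^delta <= 2
   alpha(t)^delta; the leading 1 makes the final inequality strict. *)
pose x := eps0 / (1 + 2 * ((1 + K) * (1 + #|I|%:R) + K)).
have den : 1 <= 1 + 2 * ((1 + K) * (1 + #|I|%:R) + K).
  by rewrite lerDl !mulr_ge0 // addr_ge0 // mulr_ge0 // addr_ge0.
have x0 : 0 < x by rewrite divr_gt0 //; lra.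
have x20 : 0 < x ^+ 2 by rewrite exprn_gt0.
have [m1 _ hm1] : \forall m \near \oo, [/\ good m, z m w < x ^+ 2 &
    p m `^ (2 * (1 - delta)) * Sn m w ^+ 2 < x ^+ 2].
  near=> m; split.
  - by near: m.
  - have : `|0 - z m w| < x ^+ 2 by near: m; apply: (cvgrPdist_lt _ _).1.
    by rewrite sub0r normrN; apply: le_lt_trans; exact: ler_norm.
  - have : `|0 - p m `^ (2 * (1 - delta)) * Sn m w ^+ 2| < x ^+ 2.
      by near: m; apply: (cvgrPdist_lt _ _).1.
    by rewrite sub0r normrN; apply: le_lt_trans; exact: ler_norm.
exists (m1 * h)%N => // t /= ht; rewrite sub0r normrN.
set m := (t %/ h)%N; set k := (t %% h)%N.
have tE : t = (m * h + k)%N by exact: divn_eq.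
have kh : (k < h)%N by rewrite ltn_mod.
have [gm zm sm] : [/\ good m, z m w < x ^+ 2 & p m `^ (2 * (1 - delta)) * Sn m w ^+ 2 < x ^+ 2].
  by apply: hm1; rewrite /= leq_divRL.
have [_ _ _ al _] := gm.
have [hl1 _] := path_step gm bw.
have pm := p0 m; have gp : 0 < p m `^ delta by exact: powR_gt0.
have ag : 0 < alpha t `^ delta by exact: powR_gt0.
have palpha : p m `^ delta <= 2 * alpha t `^ delta.
  apply: powR_le_double => //; first by have := delta0; have := delta1; lra.
  have := al (widen_ord (leqnSn h) (Ordinal kh)).
  by rewrite /= -/(p m) -tE ler_norml; have := p0 m; lra.
(* [1 + #|I|] replaces the square root of [#|I|] from Cauchy-Schwarz. *)
have N0x : N0 m w <= (1 + #|I|%:R) * (x * p m `^ delta).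
  have rhs0 : 0 <= (1 + #|I|%:R) * (x * p m `^ delta).
    by rewrite mulr_ge0 ?addr_ge0 // mulr_ge0 ?ltW.
  rewrite -ler_sqr ?nnegrE //.
  apply: le_trans (l1_sqr_le _) _; rewrite -/(sq m w).
  have sqx : sq m w <= x ^+ 2 * p m `^ (2 * delta).
    by move: zm; rewrite /z mulrC ltr_pdivrMr ?powR_gt0 // => /ltW.
  rewrite sqrpow -exprMn in sqx.
  apply: le_trans (ler_wpM2l (ler0n _ _) sqx) _.
  rewrite [leRHS]exprMn ler_wpM2r ?sqr_ge0 // sqrrD.
  by have := sqr_ge0 (#|I|%:R : R); have := ler0n R #|I|; lra.
have Sx : p m `^ (1 - delta) * Sn m w <= x.
  have pS0 : 0 <= p m `^ (1 - delta) * Sn m w by apply: mulr_ge0; [exact: powR_ge0|exact: Sn0].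
  by rewrite -(@ler_pXn2r _ 2) ?nnegrE ?(ltW x0) // exprMn -sqrpow ltW.
have et : `|e t i w| <= (1 + K) * N0 m w + K * (x * p m `^ delta).
  apply: le_trans (le_l1 (ew t w) i) _; rewrite {1}tE.
  apply: le_trans (hl1 k (ltnW kh)) _.
  have p1 : p m <= 1 by case: gm => pe _ _ _ _; apply: le_trans pe eta1.
  have h1 : K * p m * N0 m w <= K * N0 m w.
    by rewrite ler_wpM2r // ler_piMr.
  have h2 : p m * Sn m w <= x * p m `^ delta.
    by rewrite {1}gq -mulrA mulrC ler_wpM2r // ltW.
  by have := ler_wpM2l K0 h2; lra.
rewrite normrM normfV (gtr0_norm ag) mulrC ltr_pdivrMr //.
apply: le_lt_trans et _.
have h3 : (1 + K) * N0 m w <= (1 + K) * ((1 + #|I|%:R) * (x * p m `^ delta)).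
  by rewrite ler_wpM2l // addr_ge0.
apply: (@le_lt_trans _ _ (((1 + K) * (1 + #|I|%:R) + K) * x * p m `^ delta)); first by lra.
have c0 : 0 <= ((1 + K) * (1 + #|I|%:R) + K) * x.
  by rewrite mulr_ge0 ?(ltW x0) // addr_ge0 // mulr_ge0 // addr_ge0.
apply: le_lt_trans (ler_wpM2l c0 palpha) _.
rewrite mulrA ltr_pM2r //.
have -> : eps0 = x * (1 + 2 * ((1 + K) * (1 + #|I|%:R) + K)).
  by rewrite /x divfK // gt_eqF //; lra.
by have := x0; lra.
Unshelve. all: by end_near. Qed.

End Block.
Theorem stochastic_approximation :
  {ae P, forall w, forall i, (fun t => (alpha t `^ delta)^-1 * e t i w) @ \oo --> 0}.
Proof.
have [K K0 HK] := @block_ineq R I J h C C0.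
have l0 := lambda_gt0.
have KI : 0 <= 8 * K * #|I|%:R / lambda.
  by rewrite divr_ge0 ?(ltW l0) // mulr_ge0 // mulr_ge0.
(* With [eta = x^-1], the three summands give in turn [eta <= 1], [lambda * eta <= 1] and
   [4 * K * #|I| * eta <= lambda / 2]. *)
pose x := 1 + lambda + 8 * K * #|I|%:R / lambda.
have x1 : 1 <= x by rewrite /x; lra.
have x0 : 0 < x by lra.
apply: (@scaled_error_cvg0 K x^-1) => //.
- by rewrite invr_gt0.
- by rewrite invf_le1.
- rewrite ler_pdivrMr //.
  have -> : lambda / 2 * x = lambda * (1 + lambda) / 2 + 4 * K * #|I|%:R.
    by rewrite /x; field; rewrite gt_eqF.
  by rewrite lerDr divr_ge0 // mulr_ge0 ?ltW // addr_gt0.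
- by apply: regular; rewrite invr_gt0.
- by rewrite ler_pdivrMr // /x; lra.
Qed.

End StochasticApproximation.

(** * Smallest eigenvalue and quadratic forms *)

Lemma cvg_sumr {R : realType} {U K : Type} (F : set_system U) (FF : Filter F) (s : seq K)
  (f : K -> U -> R) (l : K -> R) : (forall k, f k @ F --> l k) ->
  (fun x => \sum_(k <- s) f k x) @ F --> \sum_(k <- s) l k.
Proof.
move=> fl; elim: s => [|k s IH].
  rewrite big_nil; under eq_fun do rewrite big_nil; exact: cvg_cst.
by rewrite big_cons; under eq_fun do rewrite big_cons; exact: cvgD.
Qed.

Section Rayleigh.
Context {R : realType} {n : nat}.
Implicit Types (A B : 'M[R]_n) (u v : 'rV[R]_n).

Definition rform A v : R := (v *m A *m v^T) 0 0.

Lemma rformE A v : rform A v = \sum_i \sum_j v 0 i * A i j * v 0 j.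
Proof.
rewrite /rform mxE exchange_big /=; apply: eq_bigr => j _.
by rewrite !mxE mulr_suml.
Qed.

Lemma rform1 v : rform 1%:M v = \sum_i v 0 i ^+ 2.
Proof. by rewrite /rform mulmx1 mxE; apply: eq_bigr => i _; rewrite mxE -expr2. Qed.

Lemma rform1_ge0 v : 0 <= rform 1%:M v.
Proof. by rewrite rform1 sumr_ge0 // => i _; exact: sqr_ge0. Qed.

Lemma rform1_eq0 v : rform 1%:M v = 0 -> v = 0.
Proof.
rewrite rform1 => /psumr_eq0P h; apply/rowP => i; rewrite mxE.
by apply/eqP; rewrite -(sqrf_eq0); apply/eqP; apply: h => // j _; exact: sqr_ge0.
Qed.

Lemma rformZ A (c : R) v : rform A (c *: v) = c ^+ 2 * rform A v.
Proof.
by rewrite /rform linearZ /= -!scalemxAl -scalemxAr mxE [in LHS]mxE mulrA expr2.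
Qed.

Lemma rform0 A : rform A 0 = 0.
Proof. by rewrite /rform !mul0mx mxE. Qed.

Lemma rformD A u v : A^T = A -> rform A (u + v) = rform A u + 2 * (u *m A *m v^T) 0 0 + rform A v.
Proof.
have addE (X Y : 'M[R]_1) : (X + Y) 0 0 = X 0 0 + Y 0 0 by rewrite mxE.
move=> sA; rewrite /rform linearD /= !mulmxDl !mulmxDr !addE.
have -> : (v *m A *m u^T) 0 0 = (u *m A *m v^T) 0 0.
  have tr (X : 'M[R]_1) : X 0 0 = X^T 0 0 by rewrite mxE.
  by rewrite [LHS]tr !trmx_mul trmxK sA mulmxA.
ring.
Qed.

Lemma continuous_rform A : continuous (rform A).
Proof.
have -> : rform A = fun v => \sum_i \sum_j v 0 i * A i j * v 0 j.
  by apply/funext => v; exact: rformE.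
move=> v; have coord i : (fun u : 'rV[R]_n => u 0 i) @ v --> v 0 i.
  exact: coord_continuous.
apply: (@cvg_sumr _ _ _ (nbhs v)) => i; apply: (@cvg_sumr _ _ _ (nbhs v)) => j.
by apply: (cvgM _ (coord j)); apply: (cvgM (coord i)); exact: cvg_cst.
Qed.

(** The form attains its minimum [mu] on the compact unit sphere, nonempty thanks to [u]. Then
    [A - mu] is positive semidefinite with a form vanishing at the minimiser, and first-order
    variation puts the minimiser in its kernel. *)
Lemma rayleigh_min A u : A^T = A -> u != 0 ->
  exists mu, eigenvalue A mu /\ forall v, mu * rform 1%:M v <= rform A v.
Proof.
move=> sA u0.
have Npos v : v != 0 -> 0 < rform 1%:M v.
  by move=> v0; rewrite lt_def rform1_ge0 andbT; apply: contra_neq v0; exact: rform1_eq0.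
have normalize v : v != 0 -> rform 1%:M ((Num.sqrt (rform 1%:M v))^-1 *: v) = 1.
  move=> v0; rewrite rformZ exprVn sqr_sqrtr ?rform1_ge0 // mulVf //.
  by rewrite gt_eqF // Npos.
pose K := [set v : 'rV[R]_n | rform 1%:M v = 1].
have cK : compact K.
  apply: (@subclosed_compact _ _ [set v : 'rV[R]_n | forall i, v ord0 i \in `[(-1 : R), 1]]).
  - rewrite (_ : K = rform 1%:M @^-1` [set 1]) //.
    by apply: closed_comp => [v _|]; [exact: continuous_rform|exact: closed_eq].
  - by apply: (@rV_compact R n (fun=> `[(-1 : R), 1]%classic)) => i; exact: segment_compact.
  - move=> v /= vK i; rewrite in_itv /= -ler_norml.
    rewrite -(@ler_pXn2r _ 2) ?nnegrE // expr1n real_normK ?num_real // -vK rform1.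
    by rewrite (bigD1 i) //= lerDl sumr_ge0 // => *; exact: sqr_ge0.
have [||| v0 v0K v0min] := @EVT_min_rV R n (rform A) K.
- by exists ((Num.sqrt (rform 1%:M u))^-1 *: u); exact: normalize.
- exact: cK.
- by apply: continuous_subspaceT; exact: continuous_rform.
move: v0K; rewrite inE => v0K.
pose mu := rform A v0; pose B := A - mu%:M.
have rB v : rform B v = rform A v - mu * rform 1%:M v.
  rewrite /rform /B mulmxBr mulmxBl mul_mx_scalar -scalemxAl mulmx1.
  by rewrite mxE; congr (_ + _); rewrite mxE; congr (- _); rewrite mxE.
have sB : B^T = B by rewrite /B linearB /= sA tr_scalar_mx.
have B0 v : 0 <= rform B v.
  have [->|vn0] := eqVneq v 0; first by rewrite rform0.
  have := v0min ((Num.sqrt (rform 1%:M v))^-1 *: v); rewrite inE => /(_ (normalize v vn0)).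
  rewrite rformZ exprVn sqr_sqrtr ?rform1_ge0 // ler_pdivlMl ?Npos // rB subr_ge0.
  by rewrite mulrC.
have Bv0 : rform B v0 = 0 by rewrite rB v0K mulr1 subrr.
pose g := v0 *m B.
have g0 : g = 0.
  apply: rform1_eq0; apply/eqP; rewrite eq_le rform1_ge0 andbT.
  have first_order s : 0 <= 2 * (s * rform 1%:M g) + s ^+ 2 * rform B g.
    have := B0 (v0 + s *: g); rewrite (rformD _ _ sB) Bv0 add0r rformZ.
    by rewrite linearZ /= -scalemxAr mxE -/g /rform mulmx1.
  have Bg := B0 g; have Ng := rform1_ge0 g.
  set b := rform B g in first_order Bg; set N := rform 1%:M g in first_order Ng *.
  have b1 : 0 < b + 1 by rewrite ltr_wpDl.
  (* The variation by [- t] would give 0 <= -2 t N + t^2 b <= - t N < 0; the added 1 covers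
     [b = 0]. *)
  rewrite leNgt; apply/negP => N0; pose t := N / (b + 1).
  have t0 : 0 < t by rewrite divr_gt0.
  have tb : t * b <= N by rewrite /t mulrAC ler_pdivrMr // ler_pM2l //; lra.
  have h1 := ler_wpM2l (ltW t0) tb; have h2 := mulr_gt0 t0 N0.
  by have := first_order (- t); rewrite sqrrN expr2 mulNr; lra.
exists mu; split.
  apply/eigenvalueP; exists v0.
    by apply/eqP; rewrite -subr_eq0 -mul_mx_scalar -mulmxBr -/B -/g g0.
  apply: contra_eq_neq v0K => ->.
  by rewrite rform0 eq_sym oner_eq0.
by move=> v; have := B0 v; rewrite rB subr_ge0.
Qed.

(** An infimum lies below the members of its set only if the set is bounded below; the Rayleigh
    minimum is an eigenvalue and also such a bound. The case [v = 0] includes dimension 0, where no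
    eigenvalue exists. *)
Lemma lambda_min_rform A (c : R) v : A^T = A -> c <= lambda_min A ->
  c * \sum_i v 0 i ^+ 2 <= \sum_i \sum_j v 0 i * A i j * v 0 j.
Proof.
move=> sA cA; rewrite -rform1 -rformE.
have [->|v0] := eqVneq v 0; first by rewrite !rform0 mulr0.
have [mu [eig_mu mu_min]] := rayleigh_min sA v0.
apply: le_trans (mu_min v); rewrite ler_wpM2r ?rform1_ge0 //.
apply: le_trans cA _; apply: ge_inf => //.
exists mu => a /= /eigenvalueP[u uA u0].
have Nu : 0 < rform 1%:M u.
  by rewrite lt_def rform1_ge0 andbT; apply: contra_neq u0; exact: rform1_eq0.
rewrite -(ler_pM2r Nu); apply: le_trans (mu_min u) _.
by rewrite /rform uA mulmx1 -scalemxAl mxE.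
Qed.

End Rayleigh.

(** * Block matrices and the event-triggered trajectory *)

Section Norms.
Context {R : realType}.

Lemma vnorm_sqr n (x : 'cV[R]_n) : vnorm x ^+ 2 = \sum_(k < n) x k 0 ^+ 2.
Proof. by rewrite sqr_sqrtr // sumr_ge0 // => k _; exact: sqr_ge0. Qed.

Lemma vnorm_ge0 n (x : 'cV[R]_n) : 0 <= vnorm x.
Proof. exact: sqrtr_ge0. Qed.

Lemma vnorm0 n : vnorm (0 : 'cV[R]_n) = 0.
Proof. by rewrite /vnorm big1 ?sqrtr0 // => k _; rewrite mxE expr0n. Qed.

Lemma le_vnorm n (x : 'cV[R]_n) k : `|x k 0| <= vnorm x.
Proof.
rewrite -(@ler_pXn2r _ 2) ?nnegrE ?vnorm_ge0 // vnorm_sqr real_normK ?num_real //.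
by rewrite (bigD1 k) //= lerDl sumr_ge0 // => *; exact: sqr_ge0.
Qed.

(** Tested on a basis vector. As [opnorm] is a real supremum, boundedness of the set must be shown,
    here by a crude bound from the row sums. *)
Lemma entry_le_opnorm (n q : nat) (A : 'M[R]_(n, q)) i j : `|A i j| <= opnorm A.
Proof.
apply: le_trans (_ : vnorm (A *m delta_mx j 0) <= _).
  apply: le_trans (le_vnorm _ i); rewrite mxE (bigD1 j) //= mxE !eqxx mulr1.
  by rewrite big1 ?addr0 // => k kj; rewrite mxE (negbTE kj) mulr0.
apply: ub_le_sup; last first.
  exists (delta_mx j 0) => //=.
  rewrite -(@ler_pXn2r _ 2) ?nnegrE ?vnorm_ge0 // vnorm_sqr expr1n (bigD1 j) //=.
  rewrite mxE !eqxx expr1n big1 ?addr0 // => k kj.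
  by rewrite mxE (negbTE kj) expr0n.
exists (Num.sqrt (\sum_k (\sum_l `|A k l|) ^+ 2)) => _ [x /= x1 <-].
rewrite ler_sqrt; last by rewrite sumr_ge0 // => k _; exact: sqr_ge0.
apply: ler_sum => k _; rewrite -real_normK ?num_real //.
rewrite ler_sqr ?nnegrE ?sumr_ge0 //.
rewrite mxE (le_trans (ler_norm_sum _ _ _)) //; apply: ler_sum => l _.
by rewrite normrM ler_piMr // (le_trans (le_vnorm _ _)).
Qed.

End Norms.

Section BlockAlgebra.
Context {R : realType} {N M : nat} {m : 'I_N -> nat}.
Implicit Types (a : 'I_N -> 'I_N -> R) (z : 'I_N -> 'cV[R]_M) (Hs : forall i : 'I_N, 'M[R]_(m i, M)).

Lemma stackE z p : stack z p 0 = z (tagnat.sig1 p) (tagnat.sig2 p) 0.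
Proof. by rewrite mxE. Qed.

(** The Kronecker product of the Laplacian with the identity, the nonsymmetric counterpart of
    [LbarI]. *)
Definition lapI a : 'M[R]_(\sum_(i < N) M) :=
  @mxblock R N N (fun _ => M) (fun _ => M) (fun i j => (laplacian a i j)%:M).

Lemma lapI_stack a z : lapI a *m stack z = stack (fun i => \sum_j a i j *: (z i - z j)).
Proof.
rewrite /lapI /stack mul_mxblock_mxrow; apply: eq_mxcol => i.
under eq_bigr => j _ do rewrite mul_scalar_mx !mxE scalerBl.
under [RHS]eq_bigr => j _ do rewrite scalerBr.
rewrite !sumrB; congr (_ - _).
rewrite (bigD1 i) //= eqxx mulr1n [X in _ + X]big1 ?addr0 ?scaler_suml // => j ji.
by rewrite eq_sym (negbTE ji) mulr0n scale0r.
Qed.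

Lemma DHmx_mxcol Hs (y : forall i : 'I_N, 'cV[R]_(m i)) :
  DHmx Hs *m @mxcol R N m 1 y = stack (fun i => (Hs i)^T *m y i).
Proof.
rewrite /DHmx /stack mul_mxblock_mxrow; apply: eq_mxcol => i.
rewrite (bigD1 i) //= eqxx big1 ?addr0 // => j ji.
by rewrite eq_sym (negbTE ji) mul0mx.
Qed.

Lemma tr_DHmx_stack Hs z : (DHmx Hs)^T *m stack z = @mxcol R N m 1 (fun i => Hs i *m z i).
Proof.
rewrite /DHmx /stack tr_mxblock mul_mxblock_mxrow; apply: eq_mxcol => i.
rewrite (bigD1 i) //= eqxx trmxK big1 ?addr0 // => j ji.
by rewrite (negbTE ji) trmx0 mul0mx.
Qed.

Lemma LbarE a i j : Lbar a i j = 2^-1 * (laplacian a i j + laplacian a j i).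
Proof. by rewrite /Lbar !mxE. Qed.

(** A quadratic form sees only the symmetric part of its matrix. This links the Laplacian in the
    algorithm to its symmetrisation in the excitation assumption. *)
Lemma qform_lapI a (X : 'M[R]_(\sum_(i < N) M)) e :
  qform (fun p q => (lapI a + X) p q) e = qform (fun p q => (LbarI M a + X) p q) e.
Proof.
rewrite /qform.
have split (Y : 'M[R]_(\sum_(i < N) M)) : \sum_p \sum_q e p * (Y + X) p q * e q =
    \sum_p \sum_q e p * Y p q * e q + \sum_p \sum_q e p * X p q * e q.
  rewrite -big_split; apply: eq_bigr => p _; rewrite -big_split; apply: eq_bigr => q _ /=.
  by rewrite mxE mulrDr mulrDl.
rewrite !split; congr (_ + _).
have -> : \sum_p \sum_q e p * LbarI M a p q * e q =
   2^-1 * (\sum_p \sum_q e p * lapI a p q * e q + \sum_p \sum_q e p * lapI a q p * e q).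
  rewrite -big_split mulr_sumr; apply: eq_bigr => p _.
  rewrite -big_split mulr_sumr; apply: eq_bigr => q _ /=.
  have -> : LbarI M a p q = 2^-1 * (lapI a p q + lapI a q p); last by ring.
  rewrite /LbarI /lapI ![(mxblock _) _ _]mxE ![(_%:M) _ _]mxE.
  by rewrite LbarE [tagnat.sig2 q == _]eq_sym -mulrnDl mulrnAr.
rewrite [X in _ + X]exchange_big /=.
have -> : \sum_q \sum_p e p * lapI a q p * e q = \sum_p \sum_q e p * lapI a p q * e q.
  by apply: eq_bigr => p _; apply: eq_bigr => q _; ring.
by field.
Qed.

End BlockAlgebra.

Lemma le_fmax {R : realType} (N : nat) (f : 'I_N -> nat -> R) t i : f i t <= fmax f t.
Proof. exact: le_bigmax. Qed.

Lemma fmax_ge0 {R : realType} (N : nat) (f : 'I_N -> nat -> R) t : 0 <= fmax f t.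
Proof. by rewrite /fmax; exact: bigmax_ge_id. Qed.

Section Trajectory.
Context {R : realType} {N M : nat} {m : 'I_N -> nat}.
Variables (a : 'I_N -> 'I_N -> R) (alp f : 'I_N -> nat -> R) (theta : 'cV[R]_M)
  (x0 : 'I_N -> 'cV[R]_M) (Hs : forall i : 'I_N, nat -> 'M[R]_(m i, M))
  (vs : forall i : 'I_N, nat -> 'cV[R]_(m i)).
Hypotheses (a0 : forall i j, 0 <= a i j) (f0 : forall i t, 0 <= f i t).
Let x t := (traj a alp f theta x0 Hs vs t).1.
Let xh t := (traj a alp f theta x0 Hs vs t).2.

Definition err t := stack (fun i => x t i - theta).
Definition trig_err t :=
  stack (fun i => \sum_(j < N | 0 < a i j) a i j *: (xh t j - x t j)).

Lemma trajS t i : x t.+1 i = x t i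
  + alp i t *: ((Hs i t)^T *m ((Hs i t *m theta + vs i t) - Hs i t *m x t i))
  + alp i t *: \sum_(j < N | 0 < a i j) a i j *: (xh t j - x t i).
Proof. by rewrite /x /xh /=; case: (traj _ _ _ _ _ _ _ t). Qed.

Lemma traj_hatS t i : xh t.+1 i = if f i t.+1 < vnorm (x t.+1 i - xh t i) then x t.+1 i else xh t i.
Proof. by rewrite /x /xh /=; case: (traj _ _ _ _ _ _ _ t). Qed.

(** A sensor that sends has gap 0, also at time 0, and a silent one has failed the strict test. *)
Lemma trigger_gap t i : vnorm (x t i - xh t i) <= f i t.
Proof.
case: t => [|t]; first by rewrite /x /xh /= subrr vnorm0.
rewrite traj_hatS; case: ltP => // _.
by rewrite subrr vnorm0.
Qed.

Lemma trig_err_le t p : `|trig_err t p 0| <= (\sum_i \sum_j a i j) * fmax f t.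
Proof.
rewrite stackE; set i := tagnat.sig1 p; rewrite summxE.
apply: le_trans (ler_norm_sum _ _ _) _.
apply: (@le_trans _ _ (\sum_j a i j * fmax f t)).
  rewrite big_mkcond; apply: ler_sum => j _; case: ifP => _; last first.
    by rewrite mulr_ge0 // fmax_ge0.
  rewrite mxE normrM ger0_norm // ler_wpM2l //.
  apply: le_trans (le_fmax f t j); apply: le_trans (trigger_gap t j).
  by rewrite -opprB mxE normrN le_vnorm.
rewrite -mulr_suml ler_wpM2r ?fmax_ge0 // [leRHS](bigD1 i) //= lerDl.
by apply: sumr_ge0 => k _; apply: sumr_ge0.
Qed.

(** The received estimate enters as hat x_j - x_i = (hat x_j - x_j) - ((x_i - theta) - (x_j -
    theta)): the first part is the trigger error, the second the Laplacian acting on the errors. *)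
Lemma err_rec t p : err t.+1 p 0 = err t p 0 + alp (tagnat.sig1 p) t *
  drive (fun p q => (lapI a + DHmx (Hs ^~ t) *m (DHmx (Hs ^~ t))^T) p q)
    (fun p r => DHmx (Hs ^~ t) p r) (fun p => trig_err t p 0)
    (fun r => @mxcol R N m 1 (vs ^~ t) r 0) (fun p => err t p 0) p.
Proof.
set H := DHmx _; set v := mxcol _.
have -> : drive (fun p q => (lapI a + H *m H^T) p q) (fun p r => H p r)
    (fun p => trig_err t p 0) (fun r => v r 0) (fun p => err t p 0) p =
    (- ((lapI a + H *m H^T) *m err t) + trig_err t + H *m v) p 0.
  by rewrite /drive [RHS]mxE [X in _ = X + _]mxE [X in _ = X + _ + _]mxE
    [(_ *m err t) p 0]mxE [(_ *m v) p 0]mxE.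
rewrite mulmxDl -mulmxA /err tr_DHmx_stack !DHmx_mxcol lapI_stack /trig_err.
have addE' (X Y : 'cV[R]_(\sum_(i < N) M)) : (X + Y) p 0 = X p 0 + Y p 0 by rewrite mxE.
have oppE' (X : 'cV[R]_(\sum_(i < N) M)) : (- X) p 0 = - X p 0 by rewrite mxE.
rewrite !(addE', oppE').
rewrite !stackE; set i := tagnat.sig1 p; set k := tagnat.sig2 p.
rewrite trajS.
have -> : \sum_(j < N | 0 < a i j) a i j *: (xh t j - x t i) =
   \sum_(j < N | 0 < a i j) a i j *: (xh t j - x t j)
   - \sum_j a i j *: (x t i - theta - (x t j - theta)).
  (* The Laplacian sums over all sensors, the algorithm over parents only; the remaining weights are
     0 because weights are nonnegative. *)
  rewrite [X in _ - X](bigID (fun j => 0 < a i j)) /= [X in _ - (_ + X)]big1 ?addr0.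
    rewrite -sumrB; apply: eq_bigr => j _; rewrite -scalerBr; congr (_ *: _).
    by apply/matrixP => u v'; rewrite !mxE; ring.
  by move=> j; rewrite lt_neqAle a0 andbT negbK => /eqP <-; rewrite scale0r.
have -> : Hs i t *m theta + vs i t - Hs i t *m x t i =
   vs i t - Hs i t *m (x t i - theta).
  by rewrite mulmxBr; apply/matrixP => u v'; rewrite !mxE; ring.
rewrite [(Hs i t)^T *m (_ - _)]mulmxBr.
set A1 := \sum_(j < N | _) _; set A2 := \sum_(j < N) _; set A3 := _ *m vs i t; set A4 := _ *m (_ *m _).
have addE (X Y : 'cV[R]_M) : (X + Y) k 0 = X k 0 + Y k 0 by rewrite mxE.
have oppE (X : 'cV[R]_M) : (- X) k 0 = - X k 0 by rewrite mxE.
have sclE c (X : 'cV[R]_M) : (c *: X) k 0 = c * X k 0 by rewrite mxE.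
rewrite !(addE, oppE, sclE); ring.
Qed.

End Trajectory.

(** * Measurability, conditional expectation and independence *)

Section TrajectoryMeasurability.
Context {d : measure_display} {T : measurableType d} {R : realType}.

Lemma measurable_vnorm n (y : T -> 'cV[R]_n) : (forall k, measurable_fun setT (fun w => y w k 0)) ->
  measurable_fun setT (fun w => vnorm (y w)).
Proof.
move=> my; have msqrt : measurable_fun setT (@Num.sqrt R).
  by apply: continuous_measurable_fun; exact: sqrt_continuous.
have msum : measurable_fun setT (fun w => \sum_k y w k 0 ^+ 2).
  by apply: measurable_sum => k; apply: measurable_funX.
exact: measurableT_comp msqrt msum.
Qed.

Context {N M : nat} {m : 'I_N -> nat}.
Variables (a : 'I_N -> 'I_N -> R) (alp f : 'I_N -> nat -> R) (theta : 'cV[R]_M)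
  (x0 : 'I_N -> 'cV[R]_M) (H : forall i : 'I_N, nat -> T -> 'M[R]_(m i, M))
  (v : forall i : 'I_N, nat -> T -> 'cV[R]_(m i)).
Let tr w := traj a alp f theta x0 (fun i s => H i s w) (fun i s => v i s w).

(** Measurability is asked only of observations strictly before [t], so that [T] may be instantiated
    with the sigma-algebra of the past, which yields adaptedness. *)
Lemma measurable_traj t :
  (forall i s r c, (s < t)%N -> measurable_fun setT (fun w => H i s w r c)) ->
  (forall i s k, (s < t)%N -> measurable_fun setT (fun w => v i s w k 0)) ->
  forall i k, measurable_fun setT (fun w => (tr w t).1 i k 0) /\
    measurable_fun setT (fun w => (tr w t).2 i k 0).
Proof.
elim: t => [|t IH] mH mv i k; first by split => /=; exact: measurable_cst.
have {}IH := IH (fun i s r c st => mH i s r c (ltnW st)) (fun i s k st => mv i s k (ltnW st)).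
have mHt j r c : measurable_fun setT (fun w => H j t w r c) by exact: mH.
have mvt j c : measurable_fun setT (fun w => v j t w c 0) by exact: mv.
have mx j c : measurable_fun setT (fun w => (tr w t.+1).1 j c 0).
  rewrite (_ : (fun w => _) = fun w => (tr w t).1 j c 0 +
    alp j t * \sum_r H j t w r c * ((\sum_l H j t w r l * theta l 0) + v j t w r 0 -
        \sum_l H j t w r l * (tr w t).1 j l 0) +
    alp j t * \sum_(l < N | 0 < a j l) a j l * ((tr w t).2 l c 0 - (tr w t).1 j c 0)).
    apply: measurable_funD; first apply: measurable_funD; first exact: (IH j c).1.
      apply: measurable_funM => //; apply: measurable_sum => r; apply: measurable_funM => //.
      apply: measurable_funB.
        apply: measurable_funD => //.
        by apply: measurable_sum => l; apply: measurable_funM.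
      by apply: measurable_sum => l; apply: measurable_funM => //; exact: (IH j l).1.
    apply: measurable_funM => //; under eq_fun do rewrite big_mkcond.
    apply: measurable_sum => l; case: (0 < a j l) => //.
    apply: measurable_funM => //; apply: measurable_funB.
      exact: (IH l c).2.
    exact: (IH j c).1.
  apply/funext => w; rewrite /tr (trajS a alp f theta x0 (fun i s => H i s w) (fun i s => v i s w)) !mxE; congr (_ + _ * _ + _ * _).
    by apply: eq_bigr => r _; rewrite !mxE.
  by rewrite summxE; apply: eq_bigr => l _; rewrite !mxE.
split; first exact: mx.
rewrite (_ : (fun w => _) = fun w =>
   if f i t.+1 < vnorm ((tr w t.+1).1 i - (tr w t).2 i) then (tr w t.+1).1 i k 0
   else (tr w t).2 i k 0).
  apply: measurable_fun_ifT => //; last exact: (IH i k).2.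
  apply: measurable_fun_ltr => //; apply: measurable_vnorm => l.
  under eq_fun do rewrite !mxE; apply: measurable_funB; first exact: mx.
  exact: (IH i l).2.
by apply/funext => w; rewrite /tr (traj_hatS a alp f theta x0 (fun i s => H i s w) (fun i s => v i s w)); case: ifP.
Qed.

End TrajectoryMeasurability.

Section ConditionalExpectation.
Context {d : measure_display} {T : measurableType d} {R : realType} (P : probability T R).

Lemma cond_exp_versionP (G : set (set T)) (X Y : T -> R) : G `<=` measurable ->
  cond_exp_version P G X Y ->
  [/\ L1 P X, L1 P Y, (forall B, measurable B -> G (Y @^-1` B)) &
    forall A, G A -> Ex P (fun w => \1_A w * (X w - Y w)) = 0].
Proof.
move=> Gm [iX mY iY XY]; split => // A GA; have mA := Gm _ GA.
have := XY A GA; rewrite !int_eq_Ex // => -[E].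
rewrite (Ex_ext P (Y := fun w => \1_A w * X w - \1_A w * Y w)); last by move=> w; rewrite mulrBr.
by rewrite ExB ?E ?subrr //; exact: L1_indicM.
Qed.

(** The difference of the versions is tested against its own sign, a bounded weight measurable for
    the sub-sigma-algebra. *)
Lemma cond_exp_unique (S : set (set T)) (X Y Y' : T -> R) : S `<=` measurable ->
  cond_exp_version P <<s S >> X Y -> cond_exp_version P <<s S >> X Y' ->
  {ae P, forall w, Y w = Y' w}.
Proof.
move=> Sm; have Gm A : <<s S >> A -> measurable A by exact: gsigma_measurable.
move=> /(cond_exp_versionP Gm)[iX iY gY hY] /(cond_exp_versionP Gm)[_ iY' gY' hY'].
pose Z w : R := if 0 <= Y w - Y' w then 1 else -1.
have iD : L1 P (fun w => Y w - Y' w) by exact: L1B.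
have : Ex P (fun w => `|Y w - Y' w|) = 0.
  rewrite (Ex_ext P (Y := fun w => Z w * (Y w - Y' w))); last first.
    move=> w; rewrite /Z; case: ifP => [/ger0_norm ->|/negbT]; first by rewrite mul1r.
    by rewrite -ltNge => /ltr0_norm ->; rewrite mulN1r.
  apply: (@orth_bounded _ _ _ P S _ _ 1) => //.
  - move=> A GA; have mA := Gm _ GA.
    rewrite (Ex_ext P (Y := fun w => \1_A w * (X w - Y' w) - \1_A w * (X w - Y w))); last first.
      by move=> w; ring.
    rewrite ExB ?hY ?hY' ?subrr //; apply: L1_indicM => //; exact: L1B.
  - have /gmeasP mYs : gmeas S Y by [].
    have /gmeasP mY's : gmeas S Y' by [].
    apply/gmeasP; apply: measurable_fun_ifT => //.
    by apply: measurable_fun_ler => //; exact: measurable_funB.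
  - by move=> w; rewrite /Z; case: ifP => _; rewrite ?normrN normr1.
move=> /(Ex_norm_eq0 iD); apply: filterS => w /eqP.
by rewrite subr_eq0 => /eqP.
Qed.

End ConditionalExpectation.

Section Independence.
Context {d : measure_display} {T : measurableType d} {R : realType} (P : probability T R).

(** By independence the centred indicator of [AH] is orthogonal to every event of [SV], hence by
    [orth] to [W]. *)
Lemma indep_Ex (SH SV : set (set T)) (AH : set T) (W : T -> R) :
  SH `<=` measurable -> SV `<=` measurable ->
  (forall A B, <<s SH >> A -> <<s SV >> B -> P (A `&` B) = (P A * P B)%E) ->
  <<s SH >> AH -> gmeas SV W -> L1 P W ->
  Ex P (fun w => \1_AH w * W w) = fine (P AH) * Ex P W.
Proof.
move=> SHm SVm ind hAH gW iW.
have mAH := gsigma_measurable SHm hAH.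
set c := fine (P AH).
have iAH : L1 P (fun w => \1_AH w).
  by apply: L1_ext (L1_indicM mAH (L1_cst P 1)) _ => w; rewrite mulr1.
have iAW : L1 P (fun w => \1_AH w * W w) by exact: L1_indicM.
apply/eqP; rewrite -subr_eq0 -ExZ // -ExB //; last exact: L1Z.
rewrite (Ex_ext P (Y := fun w => W w * (\1_AH w - c))); last by move=> w; ring.
apply/eqP; apply: (@orth _ _ _ P SV) => //.
- exact: L1B iAH (L1_cst P c).
- move=> A sA; have mA := gsigma_measurable SVm sA.
  have iA : L1 P (fun w => \1_A w).
    by apply: L1_ext (L1_indicM mA (L1_cst P 1)) _ => w; rewrite mulr1.
  rewrite (Ex_ext P (Y := fun w => \1_(AH `&` A) w - c * \1_A w)); last first.
    by move=> w; rewrite indicI /=; ring.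
  rewrite ExB; [|by apply: (L1_ext (L1_indicM mA iAH)) => w; rewrite indicI /= mulrC|exact: L1Z].
  rewrite ExZ // !Ex_indic ?ind ?fineM ?subrr //; try exact: fin_num_measure.
  exact: measurableI.
- by apply: (L1_ext (L1B iAW (L1Z c iW))) => w; ring.
Qed.

(** On an intersection of an event of [SH] and one of [SV'] the integral factors by [indep_Ex], with
    vanishing second factor. These intersections form a pi-system generating the joint
    sigma-algebra. *)
Lemma indep_mds (SH SV SV' : set (set T)) (X : T -> R) :
  SH `<=` measurable -> SV `<=` measurable -> SV' `<=` SV ->
  (forall A B, <<s SH >> A -> <<s SV >> B -> P (A `&` B) = (P A * P B)%E) ->
  gmeas SV X -> L1 P X ->
  (forall A, <<s SV' >> A -> Ex P (fun w => \1_A w * X w) = 0) ->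
  forall A, <<s SH `|` SV' >> A -> Ex P (fun w => \1_A w * X w) = 0.
Proof.
move=> SHm SVm SV'SV ind gX iX hX.
have SV'm : SV' `<=` measurable by exact: subset_trans SVm.
pose Pi := [set C | exists A B, [/\ <<s SH >> A, <<s SV' >> B & C = A `&` B]].
have Pim : Pi `<=` measurable.
  move=> _ [A [B [sA sB ->]]]; apply: measurableI.
    exact: gsigma_measurable SHm sA.
  exact: gsigma_measurable SV'm sB.
have sub : <<s SH `|` SV' >> `<=` <<s Pi >>.
  apply: smallest_sub; first exact: smallest_sigma_algebra.
  move=> A [hA|hA]; apply: sub_sigma_algebra.
    exists A, setT; split; [exact: sub_sigma_algebra| |by rewrite setIT].
    exact: (@measurableT _ (g_sigma_algebraType SV')).
  exists setT, A; split; [|exact: sub_sigma_algebra|by rewrite setTI].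
  exact: (@measurableT _ (g_sigma_algebraType SH)).
move=> C /sub hC.
pose Q (A : set T) := (\int[P]_(w in A) (X w)%:E = 0)%E.
suff : Q C.
  by rewrite /Q int_eq_Ex //; [move=> [] | exact: gsigma_measurable Pim hC].
have mPi A : <<s Pi >> A -> measurable A by exact: gsigma_measurable.
have iXE : P.-integrable setT (EFin \o X) by [].
have QT : Q setT.
  rewrite /Q int_eq_Ex //; congr EFin; apply: hX.
  exact: (@measurableT _ (g_sigma_algebraType SV')).
apply: (@dynkin_induction _ (g_sigma_algebraType Pi) Pi Q) => //.
- move=> _ _ [A [B [sA sB ->]]] [A' [B' [sA' sB' ->]]].
  exists (A `&` A'), (B `&` B'); split; last by rewrite setIACA.
  - exact: (@measurableI _ (g_sigma_algebraType SH)).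
  - exact: (@measurableI _ (g_sigma_algebraType SV')).
- move=> _ [A [B [sA sB ->]]].
  have mA := gsigma_measurable SHm sA; have mB := gsigma_measurable SV'm sB.
  rewrite /Q int_eq_Ex; [|exact: measurableI|by []]; congr EFin.
  rewrite (Ex_ext P (Y := fun w => \1_A w * (\1_B w * X w))); last first.
    by move=> w; rewrite indicI /= mulrA.
  rewrite (@indep_Ex SH SV) ?hX ?mulr0 //; last exact: L1_indicM.
  apply: gmeasM => //; apply: gmeas_indic.
  by apply: sub_smallest2r sB => //; exact: smallest_sigma_algebra.
- move=> A /mPi mA; rewrite /Q => QA.
  have mC := measurableC mA.
  have := QT; rewrite /Q -(setUv A) integral_setU_EFin //; last 2 first.
  - by apply: measurable_funTS; exact: L1_measurable iX.
  - by rewrite disj_set2E setICr.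
  by rewrite QA add0e.
- move=> F mF tF QF; rewrite /Q integral_bigcup //.
  - by rewrite eseries0 // => i _ _; exact: QF.
  - by move=> k; exact: mPi (mF k).
  - by apply: integrableS iXE => //; apply: bigcupT_measurable => k; exact: mPi (mF k).
Qed.

End Independence.

(** * Observations and their filtration *)

Section Observations.
Context {d : measure_display} {T : measurableType d} {R : realType} (P : probability T R)
  {N M : nat} {m : 'I_N -> nat}.
Variables (H : forall i : 'I_N, nat -> T -> 'M[R]_(m i, M))
  (v : forall i : 'I_N, nat -> T -> 'cV[R]_(m i)).

Definition past (t : nat) : set (set T) :=
  [set A | exists (i : 'I_N) (s : nat), (s < t)%N /\ exists B : set R, measurable B /\
        ((exists r c, A = (fun w => H i s w r c) @^-1` B) \/
         (exists k, A = (fun w => v i s w k 0) @^-1` B))].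
Definition eventsH : set (set T) :=
  [set A | exists (i : 'I_N) (s : nat) r c (B : set R), measurable B /\
        A = (fun w => H i s w r c) @^-1` B].
Definition eventsV : set (set T) :=
  [set A | exists (i : 'I_N) (s : nat) k (B : set R), measurable B /\
        A = (fun w => v i s w k 0) @^-1` B].
Definition pastV (t : nat) : set (set T) :=
  [set A | exists (i : 'I_N) (s : nat) k (B : set R), (s < t)%N /\ measurable B /\
        A = (fun w => v i s w k 0) @^-1` B].

Hypotheses (mH : forall i t r c, measurable_fun setT (fun w => H i t w r c))
  (mv : forall i t k, measurable_fun setT (fun w => v i t w k 0)).

(** For a successor both sides agree by definition. At time 0 there is no generator, and the trivial
    sigma-algebra is checked by hand. *)
Lemma filtr_prevE t : filtr_prev H v t = <<s past t >>.
Proof.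
case: t => [|t //]; apply/seteqP; split => [A [->|->]|].
- exact: (@measurable0 _ (g_sigma_algebraType (past 0))).
- exact: (@measurableT _ (g_sigma_algebraType (past 0))).
apply: smallest_sub; last by move=> A [i [s [+ _]]]; rewrite ltn0.
split; first by left.
  by move=> A [->|->]; [right; rewrite setD0|left; rewrite setDv].
move=> F hF; have [[n Fn]|nF] := pselect (exists n, F n = setT).
  by right; apply/seteqP; split => // w _; exists n; rewrite ?Fn.
left; apply/seteqP; split => // w [n _]; case: (hF n) => [-> //|Fn _].
by case: nF; exists n.
Qed.

Lemma past_measurable t : past t `<=` measurable.
Proof.
move=> A [i [s [_ [B [mB [[r [c ->]]|[k ->]]]]]]]; rewrite -[X in measurable X]setTI.
  exact: mH.
exact: mv.
Qed.

Lemma past_sigma_measurable t : <<s past t >> `<=` measurable.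
Proof. by move=> A; apply: gsigma_measurable; exact: past_measurable. Qed.

Lemma eventsH_measurable : eventsH `<=` measurable.
Proof. move=> A [i [s [r [c [B [mB ->]]]]]]; rewrite -[X in measurable X]setTI; exact: mH. Qed.

Lemma eventsV_measurable : eventsV `<=` measurable.
Proof. move=> A [i [s [k [B [mB ->]]]]]; rewrite -[X in measurable X]setTI; exact: mv. Qed.

Lemma pastV_eventsV t : pastV t `<=` eventsV.
Proof. by move=> A [i [s [k [B [_ [mB ->]]]]]]; exists i, s, k, B. Qed.

Lemma pastV_past t : pastV t `<=` past t.
Proof. by move=> A [i [s [k [B [st [mB ->]]]]]]; exists i, s; split => //; exists B; split => //; right; exists k. Qed.

Lemma past_mono t s : (t <= s)%N -> past t `<=` past s.
Proof. by move=> ts A [i [u [ut h]]]; exists i, u; split => //; exact: leq_trans ts. Qed.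

(** Brings events of a block start, and the error at time [s], into the sigma-algebra to which the
    noise at time [s] is orthogonal. *)
Lemma past_eventsH_pastV t s : (t <= s)%N -> <<s past t >> `<=` <<s eventsH `|` pastV s >>.
Proof.
move=> ts; apply: smallest_sub; first exact: smallest_sigma_algebra.
move=> A [i [u [ut [B [mB [[r [c ->]]|[k ->]]]]]]]; apply: sub_sigma_algebra.
  by left; exists i, u, r, c, B.
by right; exists i, u, k, B; split => //; exact: leq_trans ts.
Qed.

Lemma gmeas_past_H t i s r c : (s < t)%N -> gmeas (past t) (fun w => H i s w r c).
Proof.
by move=> st B mB; apply: sub_sigma_algebra; exists i, s; split => //; exists B; split => //;
  left; exists r, c.
Qed.

Lemma gmeas_past_v t i s k : (s < t)%N -> gmeas (past t) (fun w => v i s w k 0).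
Proof.
by move=> st B mB; apply: sub_sigma_algebra; exists i, s; split => //; exists B; split => //;
  right; exists k.
Qed.

Lemma gmeas_sub (S S' : set (set T)) (Z : T -> R) : <<s S >> `<=` <<s S' >> -> gmeas S Z -> gmeas S' Z.
Proof. by move=> SS' gZ B mB; apply: SS'; exact: gZ. Qed.

(** The martingale property is first restricted to past noise alone; independence then adjoins all
    of [H], present and future included. *)
Lemma noise_orth t i k : (forall A B, sigmaH H A -> sigmaV v B -> P (A `&` B) = (P A * P B)%E) ->
  cond_exp_version P (filtr_prev H v t) (fun w => v i t w k 0) (cst 0) ->
  forall A, <<s eventsH `|` pastV t >> A -> Ex P (fun w => \1_A w * v i t w k 0) = 0.
Proof.
move=> ind ver; have [iX _ _ _] := ver; rewrite filtr_prevE in ver.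
have [_ _ _ hver] := cond_exp_versionP (@past_sigma_measurable t) ver.
apply: (@indep_mds _ _ _ P eventsH eventsV (pastV t)) => //.
- exact: eventsH_measurable.
- exact: eventsV_measurable.
- exact: pastV_eventsV.
- by move=> B mB; apply: sub_sigma_algebra; exists i, t, k, B.
move=> A sA; have := hver A; rewrite (Ex_ext P (Y := fun w => \1_A w * v i t w k 0)).
  apply; move: sA; apply: sub_smallest2r; first exact: smallest_sigma_algebra.
  exact: pastV_past.
by move=> w /=; rewrite subr0.
Qed.

(** A square is at most 1 plus the power [rho]. The sign of [cV] is not assumed, hence its absolute
    value. *)
Lemma noise_second_moment t rho cV (r : 'I_(\sum_(i < N) m i)) : 2 < rho ->
  (exists Y, cond_exp_version P (filtr_prev H v t) (fun w => vnorm (Vst v t w) `^ rho) Y /\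
     {ae P, forall w, Y w <= cV}) ->
  L2 P (fun w => Vst v t w r 0) /\ Ex P (fun w => Vst v t w r 0 ^+ 2) <= 1 + `|cV|.
Proof.
move=> rho2 [Y [ver YcV]]; rewrite filtr_prevE in ver.
have [iX iY _ hver] := cond_exp_versionP (@past_sigma_measurable t) ver.
have mV : measurable_fun setT (fun w => Vst v t w r 0).
  by under eq_fun do rewrite mxE; exact: mv.
have bound w : Vst v t w r 0 ^+ 2 <= 1 + vnorm (Vst v t w) `^ rho.
  have vr := le_vnorm (Vst v t w) r; set y := vnorm _ in vr *.
  have y0 : 0 <= y by exact: vnorm_ge0.
  apply: (@le_trans _ _ (y ^+ 2)).
    by rewrite -[leLHS]real_normK ?num_real // ler_sqr.
  case: (lerP y 1) => y1.
    by apply: (@le_trans _ _ 1); [rewrite expr_le1|rewrite lerDl powR_ge0].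
  rewrite -powR_mulrn // (le_trans (ler_powR (ltW y1) (ltW rho2))) //.
  by rewrite lerDr.
have iV2 : L1 P (fun w => Vst v t w r 0 ^+ 2).
  apply: (L1_le _ (L1D (L1_cst P 1) iX)); first exact: measurable_funX.
  by apply: aeW => w; rewrite ger0_norm ?sqr_ge0.
split => //; apply: le_trans (Ex_le iV2 (L1D (L1_cst P 1) iX) (aeW _ bound)) _.
rewrite ExD ?Ex_cst //; last exact: L1_cst.
rewrite lerD2l; have := hver setT (@measurableT _ (g_sigma_algebraType (past t))).
rewrite (Ex_ext P (Y := fun w => vnorm (Vst v t w) `^ rho - Y w)); last first.
  by move=> w; rewrite indicT mul1r.
rewrite ExB // => /eqP; rewrite subr_eq0 => /eqP ->.
apply: le_trans (ler_norm cV); rewrite -[leRHS](Ex_cst P cV).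
by apply: Ex_le => //; exact: L1_cst.
Qed.

End Observations.

Lemma cvg_cV_entrywise {R : realType} (n : nat) (F : nat -> 'cV[R]_n) :
  (forall p, (fun t => F t p 0) @ \oo --> (0 : R)) -> F @ \oo --> (0 : 'cV[R]_n).
Proof.
move=> h; apply/cvg_ballP => e e0.
have : \forall t \near \oo, forall p, ball 0 e (F t p 0).
  by apply: filter_forall => p; have /cvg_ballP/(_ _ e0) := h p.
apply: filterS => t ht; split => // i j.
by rewrite (ord1 j) mxE; exact: ht.
Qed.

Section Drift.
Context {d : measure_display} {T : measurableType d} {R : realType} (P : probability T R)
  {n h : nat}.
Variables (S : set (set T)) (e : 'I_n -> T -> R) (X Y : 'I_h -> 'I_n -> 'I_n -> T -> R)
  (mu C : R).
Hypotheses (Sm : S `<=` measurable) (ge : forall p, gmeas S (e p)) (e2 : forall p, L2 P (e p))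
  (XY : forall k p q, cond_exp_version P <<s S >> (X k p q) (Y k p q))
  (Xsym : forall k p q w, X k p q w = X k q p w)
  (XC : {ae P, forall w, forall k p q, `|X k p q w| <= C})
  (Ymu : {ae P, forall w, mu <= lambda_min (\matrix_(p, q) \sum_k Y k p q w)}).

Lemma conditional_drift A : <<s S >> A ->
  mu * Ex P (fun w => \1_A w * sqs (e^~ w)) <=
  \sum_k Ex P (fun w => \1_A w * qform (fun p q => X k p q w) (e^~ w)).
Proof.
move=> sA; have mA := gsigma_measurable Sm sA.
have Gm A' : <<s S >> A' -> measurable A' by exact: gsigma_measurable.
have iX k p q : L1 P (X k p q) by have [] := cond_exp_versionP Gm (XY k p q).
have iY k p q : L1 P (Y k p q) by have [] := cond_exp_versionP Gm (XY k p q).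
have iQ k : L1 P (fun w => qform (fun p q => X k p q w) (e^~ w)).
  apply: L1_sum => p; apply: L1_sum => q.
  apply: (L1_ext (X := fun w => X k p q w * (e p w * e q w))); last by move=> w; ring.
  apply: (@L1_bounded_aeM _ _ _ _ _ _ C); [exact: L1_measurable (iX k p q)| |exact: L2M].
  by apply: filterS XC => w; exact.
have isq : L1 P (fun w => sqs (e^~ w)) by apply: L1_sum => p; exact: (e2 p).2.
have iAsq : L1 P (fun w => \1_A w * sqs (e^~ w)) by exact: L1_indicM.
have iAQ k : L1 P (fun w => \1_A w * qform (fun p q => X k p q w) (e^~ w)) by exact: L1_indicM.
have isum : L1 P (fun w => \sum_k \1_A w * qform (fun p q => X k p q w) (e^~ w)).
  exact: L1_sum.
rewrite -ExZ // -Ex_sum // -subr_ge0 -ExB //; last exact: L1Z.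
pose g w := l1 (e^~ w).
have gg : gmeas S g.
  apply/gmeasP; apply: measurable_sum => p; apply: measurableT_comp => //.
  by apply/gmeasP; exact: ge.
apply: (@trunc_ge0 _ _ _ P _ g) => [||K].
- by apply: L1B => //; exact: L1Z.
- exact: gmeas_measurable gg.
(* On the truncation event all error components are bounded by [K], so [W] is a bounded weight as
   [orth_bounded] requires. *)
pose Z w : R := \1_[set u | `|g u| <= K%:R] w * \1_A w.
have gZ : gmeas S Z.
  by apply: gmeasM; apply: gmeas_indic => //; exact: gmeas_norm_le.
have mZ : measurable_fun setT Z by exact: gmeas_measurable gZ.
have Z01 w : Z w = 0 \/ (Z w = 1 /\ `|g w| <= K%:R).
  rewrite /Z !indicE; case: (boolP (w \in _)) => [|_]; last by rewrite mul0r; left.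
  rewrite inE /= => gK; case: (w \in A); last by rewrite mulr0; left.
  by rewrite mulr1; right.
have Z1 w : `|Z w| <= 1 by case: (Z01 w) => [->|[-> _]]; rewrite ?normr0 ?normr1.
pose W p q w := Z w * (e p w * e q w).
have gW p q : gmeas S (W p q) by apply: gmeasM => //; apply: gmeasM.
have WK p q w : `|W p q w| <= K%:R * K%:R.
  rewrite /W; case: (Z01 w) => [->|[-> gK]]; first by rewrite mul0r normr0 mulr_ge0.
  have eK r : `|e r w| <= K%:R.
    apply: le_trans gK; rewrite [`|g w|]ger0_norm ?l1_ge0 //; exact: (le_l1 (e^~ w) r).
  by rewrite mul1r normrM ler_pM.
have mW p q : measurable_fun setT (W p q) by exact: gmeas_measurable (gW p q).
have iWX k p q : L1 P (fun w => W p q w * X k p q w) by exact: L1M_bounded (mW p q) (WK p q) _.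
have iWY k p q : L1 P (fun w => W p q w * Y k p q w) by exact: L1M_bounded (mW p q) (WK p q) _.
have EXY k p q : Ex P (fun w => W p q w * X k p q w) = Ex P (fun w => W p q w * Y k p q w).
  apply/eqP; rewrite -subr_eq0 -ExB //; apply/eqP.
  rewrite (Ex_ext P (Y := fun w => W p q w * (X k p q w - Y k p q w))); last by move=> w; ring.
  apply: (orth_bounded Sm (L1B (iX k p q) (iY k p q)) _ (gW p q) (WK p q)).
  by have [] := cond_exp_versionP Gm (XY k p q).
have iZsq : L1 P (fun w => mu * (Z w * sqs (e^~ w))) by apply: L1Z; exact: L1M_bounded mZ Z1 _.
rewrite (Ex_ext P (Y := fun w =>
  (\sum_k \sum_p \sum_q W p q w * X k p q w) - mu * (Z w * sqs (e^~ w)))); last first.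
  move=> w; rewrite mulrBr; congr (_ - _); last by rewrite /Z; ring.
  rewrite mulr_sumr; apply: eq_bigr => k _; rewrite mulrA -/(Z w) mulr_sumr.
  apply: eq_bigr => p _; rewrite mulr_sumr; apply: eq_bigr => q _; rewrite /W; ring.
have i3 (F : 'I_n -> 'I_n -> T -> R) (G : 'I_h -> 'I_n -> 'I_n -> T -> R) :
    (forall k p q, L1 P (fun w => F p q w * G k p q w)) ->
    L1 P (fun w => \sum_k \sum_p \sum_q F p q w * G k p q w).
  by move=> iFG; do 3 (apply: L1_sum => ?).
have E3 (F : 'I_n -> 'I_n -> T -> R) (G : 'I_h -> 'I_n -> 'I_n -> T -> R) :
    (forall k p q, L1 P (fun w => F p q w * G k p q w)) ->
    Ex P (fun w => \sum_k \sum_p \sum_q F p q w * G k p q w) =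
    \sum_k \sum_p \sum_q Ex P (fun w => F p q w * G k p q w).
  move=> iFG; rewrite Ex_sum; last by move=> k; do 2 (apply: L1_sum => ?).
  apply: eq_bigr => k _; rewrite Ex_sum; last by move=> p; apply: L1_sum.
  by apply: eq_bigr => p _; rewrite Ex_sum.
rewrite ExB //; last exact: i3.
rewrite E3 //; under eq_bigr => k _ do under eq_bigr => p _ do
  under eq_bigr => q _ do rewrite EXY.
rewrite -E3 // -ExB //; last exact: i3.
rewrite -[leLHS](Ex_cst P 0); apply: Ex_le; [exact: L1_cst|by apply: L1B => //; exact: i3|].
(* The entries of [Y] are separate versions, so symmetry of [X] passes to [Y] only almost surely, by
   uniqueness. *)
have Ysym : {ae P, forall w, forall k p q, Y k p q w = Y k q p w}.
  apply: filter_forall => k; apply: filter_forall => p; apply: filter_forall => q.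
  apply: (cond_exp_unique Sm (XY k p q)).
  by have -> : X k p q = X k q p by apply/funext => w; exact: Xsym.
apply: filterS2 Ymu Ysym => w muY symY.
rewrite subr_ge0; set B := \matrix_(p, q) _ in muY.
have sB : B^T = B by apply/matrixP => p q; rewrite !mxE; apply: eq_bigr => k _; exact: symY.
have := lambda_min_rform (\row_p e p w) sB muY.
have -> : \sum_i (\row_p e p w) 0 i ^+ 2 = sqs (e^~ w).
  by apply: eq_bigr => p _; rewrite mxE.
have -> : \sum_i \sum_j (\row_p e p w) 0 i * B i j * (\row_p e p w) 0 j =
    \sum_k \sum_p \sum_q e p w * e q w * Y k p q w.
  rewrite [RHS]exchange_big; apply: eq_bigr => p _; rewrite [RHS]exchange_big /=.
  apply: eq_bigr => q _; rewrite !mxE mulr_sumr mulr_suml; apply: eq_bigr => k _; ring.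
move=> hq; have Z0 : 0 <= Z w by case: (Z01 w) => [->|[-> _]].
have -> : \sum_k \sum_p \sum_q W p q w * Y k p q w =
    Z w * (\sum_k \sum_p \sum_q e p w * e q w * Y k p q w).
  rewrite mulr_sumr; apply: eq_bigr => k _; rewrite mulr_sumr; apply: eq_bigr => p _.
  by rewrite mulr_sumr; apply: eq_bigr => q _; rewrite /W -mulrA.
by rewrite mulrCA ler_wpM2l.
Qed.

End Drift.

(** * The algorithm as an instance of the linear recursion *)

Unset Implicit Arguments.

Theorem theorem2 (R : realType) (d : measure_display) (T : measurableType d)
  (P : probability T R)
  (N M : nat) (m : 'I_N -> nat) (a : 'I_N -> 'I_N -> R) (theta : 'cV[R]_M)
  (H : forall i : 'I_N, nat -> T -> 'M[R]_(m i, M))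
  (v : forall i : 'I_N, nat -> T -> 'cV[R]_(m i))
  (x0 : 'I_N -> 'cV[R]_M) (alp f : 'I_N -> nat -> R)
  (alpha : nat -> R) (alpha0 delta rho cV D lambda : R) (h : nat) :
  (* the weighted digraph *)
  (forall i j, 0 <= a i j) -> (forall i, a i i = 0) ->
  (* H_i(t), v_i(t) are random variables *)
  (forall i t r c, measurable_fun setT (fun w => H i t w r c)) ->
  (forall i t k, measurable_fun setT (fun w => v i t w k 0)) ->
  (* step sizes and thresholds *)
  (forall i t, 0 < alp i t) -> (forall i t, 0 <= f i t) ->
  (* common delta in [0, 1/2) *)
  0 <= delta < 2^-1 ->
  (* (i.a) *)
  (forall t, 0 < alpha t) ->
  (forall i, (fun t => alp i t / alpha t) @ \oo --> (1 : R)) ->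
  alpha @ \oo --> (0 : R) ->
  [series alpha t]_t @ \oo --> +oo ->
  0 <= alpha0 ->
  (fun t => (alpha t.+1)^-1 - (alpha t)^-1) @ \oo --> alpha0 ->
  (* (i.b) *)
  cvgn [series alpha t `^ (2 * (1 - delta))]_t ->
  (* (ii.a) *)
  (forall A B, sigmaH H A -> sigmaV v B -> P (A `&` B) = (P A * P B)%E) ->
  (* (ii.b) martingale difference *)
  (forall t i k, cond_exp_version P (filtr_prev H v t) (fun w => v i t w k 0) (cst 0)) ->
  2 < rho ->
  (forall t, exists Y, cond_exp_version P (filtr_prev H v t)
                         (fun w => vnorm (Vst v t w) `^ rho) Y /\
                       {ae P, forall w, Y w <= cV}) ->
  (* (ii.c) *)
  {ae P, forall w, forall t, opnorm (DH H t w) ^+ 2 <= D} ->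
  (0 < h)%N -> 0 < lambda ->
  (forall n : nat, exists Y : nat -> 'I_(\sum_(i < N) M) -> 'I_(\sum_(i < N) M) -> T -> R,
     (forall t p q, cond_exp_version P (filtr_prev H v (n * h))
                      (fun w => (LbarI M a + DH H t w *m (DH H t w)^T) p q) (Y t p q)) /\
     {ae P, forall w, lambda + h%:R * alpha0 * delta <=
            lambda_min (\sum_(n * h <= t < n.+1 * h) \matrix_(p, q) Y t p q w)}) ->
  (* (iii.a), (iii.b) *)
  (fun t => fmax f t / alpha t `^ delta) @ \oo --> (0 : R) ->
  cvgn [series alpha t `^ (1 - delta) * fmax f t]_t ->
  (* conclusion: e_0(t) / alpha^delta(t) -> 0 almost surely *)
  {ae P, forall w,
     (fun t => (alpha t `^ delta)^-1 *:
        (stack (fun i => (traj a alp f theta x0 (fun i s => H i s w) (fun i s => v i s w) t).1 i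
                         - theta))) @ \oo --> (0 : 'cV[R]_(\sum_(i < N) M))}.
Proof.
move=> a_ge0 _ mH mv _ f_ge0 /andP[delta0 delta2] alpha_gt0 alp_alpha alpha_cvg0 alpha_div
  alpha0_ge0 alpha_inv alpha_sum indep mds rho2 moment DHbound h_gt0 lambda_gt0 excite
  f_small f_sum.
have delta1 : delta <= 1 by lra.
pose n := (\sum_(i < N) M)%N; pose l := (\sum_(i < N) m i)%N.
pose Hw w i s := H i s w; pose vw w i s := v i s w.
pose e t (p : 'I_n) w := err a alp f theta x0 (Hw w) (vw w) t p 0.
pose eps t (p : 'I_n) w := trig_err a alp f theta x0 (Hw w) (vw w) t p 0.
pose X t (p q : 'I_n) w := (LbarI M a + DH H t w *m (DH H t w)^T) p q.
pose G t (p q : 'I_n) w := (lapI a + DH H t w *m (DH H t w)^T) p q.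
pose B t (p : 'I_n) (r : 'I_l) w := DH H t w p r.
pose V t (r : 'I_l) w := Vst v t w r 0.
(* From 2 x <= 1 + x^2 the operator norm is at most (1 + D)/2; this avoids the square root of
   [D]. *)
pose b := 1 + `|D|.
have b1 : 1 <= b by rewrite lerDl.
(* A common bound for the entries of [G], [X] and [B] and for the trigger errors; [l * b^2] covers
   the product of [DH] with its transpose. *)
pose C := (\sum_p \sum_q (`|(lapI a : 'M[R]_n) p q| + `|LbarI M a p q|)) + l%:R * b ^+ 2 + b
  + \sum_i \sum_j a i j.
have Lbar0 : 0 <= \sum_p \sum_q (`|(lapI a : 'M[R]_n) p q| + `|LbarI M a p q|).
  by apply: sumr_ge0 => p _; apply: sumr_ge0 => q _; rewrite addr_ge0.
have lb0 : 0 <= l%:R * b ^+ 2 by rewrite mulr_ge0 // sqr_ge0.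
have asum0 : 0 <= \sum_i \sum_j a i j by apply: sumr_ge0 => i _; exact: sumr_ge0.
have C0 : 0 <= C by rewrite /C; lra.
have gH t s i r c : (s < t)%N -> gmeas (past H v t) (fun w => H i s w r c).
  exact: gmeas_past_H.
have gB t s p r : (s < t)%N -> gmeas (past H v t) (B s p r).
  move=> st; apply/gmeasP; rewrite /B /DH /DHmx.
  under eq_fun do rewrite mxE.
  case: (eqVneq (tagnat.sig1 p) (tagnat.sig1 r)) => [_|_]; last first.
    under eq_fun do rewrite mxE; exact: measurable_cst.
  by under eq_fun do rewrite mxE; apply/gmeasP; exact: gH.
have mB t p r : measurable_fun setT (B t p r).
  by apply: gmeas_measurable (@gB t.+1 t p r (ltnSn t)); exact: past_measurable.
have mDD (L : 'M[R]_n) t (p q : 'I_n) :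
    measurable_fun setT (fun w => (L + DH H t w *m (DH H t w)^T) p q).
  under eq_fun do rewrite mxE mxE; apply: measurable_funD => //.
  apply: measurable_sum => r; under eq_fun do rewrite [X in _ * X]mxE.
  by apply: measurable_funM; exact: mB.
have ge t p : gmeas (past H v t) (e t p).
  apply/gmeasP; rewrite /e; under eq_fun do rewrite stackE !mxE.
  apply: measurable_funB => //.
  have := @measurable_traj _ (g_sigma_algebraType (past H v t)) R N M m a alp f theta x0 H v t.
  move=> /(_ _ _ (tagnat.sig1 p) (tagnat.sig2 p))[| |//].
    by move=> i s r c st; apply/gmeasP; exact: gmeas_past_H.
  by move=> i s k st; apply/gmeasP; exact: gmeas_past_v.
have DHb : {ae P, forall w, forall t p r, `|DH H t w p r| <= b}.
  apply: filterS DHbound => w hD t p r.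
  have h1 := entry_le_opnorm (DH H t w) p r; have h2 := hD t; have h3 := ler_norm D.
  have := sqr_ge0 (opnorm (DH H t w) - 1); rewrite sqrrB expr1n mulr1 /b.
  by have := le_trans (normr_ge0 _) h1; lra.
have GBX : {ae P, forall w, (forall t p q, `|G t p q w| <= C) /\ (forall t p q, `|X t p q w| <= C) /\
    (forall t p r, `|B t p r w| <= C)}.
  apply: filterS DHb => w hb.
  have DDb t p q : `|(DH H t w *m (DH H t w)^T) p q| <= l%:R * b ^+ 2.
    rewrite mxE (le_trans (ler_norm_sum _ _ _)) //.
    rewrite mulr_natl -[X in _ *+ X]card_ord -sumr_const; apply: ler_sum => r _.
    by rewrite normrM expr2 ler_pM // mxE.
  have Lb (L : 'M[R]_n) (p q : 'I_n) : `|L p q| <= \sum_p \sum_q `|L p q|.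
    rewrite (bigD1 p) //= (bigD1 q) //= -addrA lerDl addr_ge0 ?sumr_ge0 // => *.
    by rewrite sumr_ge0.
  have split : \sum_p \sum_q (`|(lapI a : 'M[R]_n) p q| + `|LbarI M a p q|) =
     \sum_p \sum_q `|(lapI a : 'M[R]_n) p q| + \sum_p \sum_q `|LbarI M a p q|.
    by rewrite -big_split; apply: eq_bigr => p _; rewrite -big_split.
  have s1 : 0 <= \sum_p \sum_q `|(lapI a : 'M[R]_n) p q|.
    by apply: sumr_ge0 => p _; exact: sumr_ge0.
  have s2 : 0 <= \sum_p \sum_q `|LbarI M a p q|.
    by apply: sumr_ge0 => p _; exact: sumr_ge0.
  split; [|split] => t p q.
  - rewrite /G mxE (le_trans (ler_normD _ _)) //.
    have := Lb (lapI a) p q; have := DDb t p q; rewrite /C split; lra.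
  - rewrite /X mxE (le_trans (ler_normD _ _)) //.
    have := Lb (LbarI M a) p q; have := DDb t p q; rewrite /C split; lra.
  - by have := hb t p q; rewrite /B /C; lra.
have GBC : {ae P, forall w, forall t, (forall p q, `|G t p q w| <= C) /\
    (forall p r, `|B t p r w| <= C)}.
  by apply: filterS GBX => w [h1 [_ h2]] t; split.
have V2 t r : L2 P (V t r) by have [] := noise_second_moment mH mv r rho2 (moment t).
have EV t r : Ex P (fun w => V t r w ^+ 2) <= 1 + `|cV|.
  by have [] := noise_second_moment mH mv r rho2 (moment t).
have e0 p : L2 P (e 0%N p).
  have -> : e 0%N p = fun=> (x0 (tagnat.sig1 p) - theta) (tagnat.sig2 p) 0.
    by apply/funext => w; rewrite /e stackE.
  exact: L2_cst.
have rec t p w : e t.+1 p w = e t p w + alp (tagnat.sig1 p) t *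
    drive (fun p q => G t p q w) (fun p r => B t p r w) (fun p => eps t p w)
      (fun r => V t r w) (fun p => e t p w) p.
  exact: err_rec.
have epsC t p w : `|eps t p w| <= C * fmax f t.
  apply: le_trans (trig_err_le _ _ _ _ _ _ _ _ _) _ => //.
  by rewrite ler_wpM2r ?fmax_ge0 // /C; lra.
have pastm t : past H v t `<=` measurable by exact: past_measurable.
have pastS t : past H v t `<=` past H v t.+1 by exact: past_mono.
have e2 := @error_L2 _ _ _ P _ _ (fmax f) (fun p => alp (tagnat.sig1 p)) e eps G B V C
  (past H v) pastm ge V2 e0 rec epsC GBC.
(* The event, the error and [DH] at time [t] are all measurable with respect to the sequence [H] and
   the noise before [t], so [orth] applies to their product. *)
have noise0 k0 (k : 'I_h) A p r : <<s past H v (k0 * h)%N >> A ->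
    Ex P (fun w => \1_A w * (e (k0 * h + k)%N p w * B (k0 * h + k)%N p r w
      * V (k0 * h + k)%N r w)) = 0.
  set t := (k0 * h + k)%N => sA.
  have tk : (k0 * h <= t)%N by rewrite leq_addr.
  pose W w := \1_A w * (e t p w * B t p r w).
  have sub : <<s past H v t >> `<=` <<s eventsH H `|` pastV v t >>.
    exact: past_eventsH_pastV.
  rewrite (Ex_ext P (Y := fun w => W w * v (tagnat.sig1 r) t w (tagnat.sig2 r) 0)); last first.
    by move=> w; rewrite /W /V mxE; ring.
  have unionm : eventsH H `|` pastV v t `<=` measurable.
    move=> A' [hA|hA]; first exact: eventsH_measurable hA.
    by apply: eventsV_measurable mv _ _; exact: pastV_eventsV hA.
  have [iX _ _ _] := mds t (tagnat.sig1 r) (tagnat.sig2 r).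
  apply: (orth unionm iX).
  - by apply: noise_orth => //; exact: mds.
  - apply: gmeasM; first by apply: gmeas_indic; exact: (past_eventsH_pastV tk).
    apply: gmeasM; first exact: gmeas_sub sub (ge t p).
    apply/gmeasP; rewrite /B /DH /DHmx; under eq_fun do rewrite mxE.
    case: (eqVneq (tagnat.sig1 p) (tagnat.sig1 r)) => [_|_]; last first.
      under eq_fun do rewrite mxE; exact: measurable_cst.
    under eq_fun do rewrite mxE; apply/gmeasP => A' mA'.
    by apply: sub_sigma_algebra; left; do 4 eexists; exists A'.
  - have mA := gsigma_measurable (pastm _) sA.
    apply: (L1_ext (X := fun w => \1_A w * (B t p r w * (e t p w * V t r w)))).
      apply: L1_indicM => //; apply: (@L1_bounded_aeM _ _ _ _ _ _ C) => //.
        by apply: filterS GBC => w /(_ t)[].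
      exact: L2M.
    by move=> w; rewrite /W /V mxE; ring.
have LbarI_sym p q : LbarI M a p q = LbarI M a q p.
  rewrite /LbarI ![(mxblock _) _ _]mxE ![(_%:M) _ _]mxE !LbarE.
  by rewrite [tagnat.sig2 p == _]eq_sym [laplacian a (tagnat.sig1 p) _ + _]addrC.
have drift k0 A : <<s past H v (k0 * h)%N >> A ->
    (lambda + h%:R * alpha0 * delta) * Ex P (fun w => \1_A w * sqs (fun p => e (k0 * h)%N p w)) <=
    \sum_(k < h) Ex P (fun w => \1_A w * qform (fun p q => G (k0 * h + k)%N p q w)
       (fun p => e (k0 * h)%N p w)).
  move=> sA; have [Y [ver lam]] := excite k0.
  rewrite filtr_prevE in ver.
  have -> : \sum_(k < h) Ex P (fun w => \1_A w * qform (fun p q => G (k0 * h + k)%N p q w)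
       (fun p => e (k0 * h)%N p w)) =
     \sum_(k < h) Ex P (fun w => \1_A w * qform (fun p q => X (k0 * h + k)%N p q w)
       (fun p => e (k0 * h)%N p w)).
    by apply: eq_bigr => k _; apply: Ex_ext => w; rewrite /G qform_lapI.
  apply: (@conditional_drift _ _ _ P n h (past H v (k0 * h)%N) (e (k0 * h)%N)
    (fun k => X (k0 * h + k)%N) (fun k => Y (k0 * h + k)%N) _ C) => //.
  - by move=> k p q; exact: ver.
  - move=> k p q w; rewrite /X [LHS]mxE [RHS]mxE LbarI_sym; congr (_ + _).
    rewrite [LHS]mxE [RHS]mxE.
    by apply: eq_bigr => r _; rewrite ![_^T _ _]mxE mulrC.
  - by apply: filterS GBX => w [_ [h1 _]] k p q; exact: h1.
  - apply: filterS lam => w; congr (_ <= lambda_min _); apply/matrixP => p q.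
    rewrite summxE -[X in \sum_(X <= _ < _) _]add0n big_addn mulSn addnK big_mkord mxE.
    by apply: eq_bigr => k _; rewrite mxE addnC.
have cV0 : 0 <= 1 + `|cV| by rewrite addr_ge0.
have mG t p q : measurable_fun setT (G t p q) by exact: mDD.
have reg eta : 0 < eta -> \forall k \near \oo,
    regular_block alpha (fmax f) (fun p : 'I_n => alp (tagnat.sig1 p)) alpha0 delta lambda h eta k.
  by apply: near_regular_block => //; exact: fmax_ge0.
have pd := block_alpha_div alpha_gt0 alpha_cvg0 alpha_div alpha_inv h_gt0.
have pp := block_alpha_pow_sum alpha_sum h_gt0.
have pF := block_threshold_sum delta0 delta2 alpha_gt0 alpha_cvg0 alpha_inv h_gt0 (fmax_ge0 f) f_sum.
have main := stochastic_approximation delta0 delta1 alpha_gt0 h_gt0 lambda_gt0 (fmax_ge0 f)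
  reg pd pp pF C0 cV0 pastm pastS ge mG mB V2 EV e0 rec epsC GBC noise0 drift.
apply: filterS main => w hw; apply: cvg_cV_entrywise => p.
rewrite (_ : (fun t => _) = fun t => (alpha t `^ delta)^-1 * e t p w); first exact: hw.
by apply/funext => t; rewrite mxE.
Qed.
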